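(* Let $\mathbb{K}$ be an infinite field and let $R=\mathbb{K}[[(\phi_1(t),\psi_1(u)),\ldots,(\phi_n(t),\psi_n(u))]]\subseteq \mathbb{K}[[t]]\times\mathbb{K}[[u]]$ be a two-branch algebroid curve. Let $R^*$ be its Arf closure and let $c=(c[1],c[2])$ be the conductor of the value semigroup $\nu(R^* )\subseteq\mathbb{N}^2$. For each $i$ let $\overline{\phi_i(t)}$ (respectively $\overline{\psi_i(u)}$) be obtained from $\phi_i(t)$ (respectively $\psi_i(u)$) by deleting all monomials of degree greater than $c[1]+1$ (respectively greater than $c[2]+1$), and set $$\overline{R}=\mathbb{K}[[(\overline{\phi_1(t)},\overline{\psi_1(u)}),\ldots,(\overline{\phi_n(t)},\overline{\psi_n(u)})]].$$ Then the blow-up algorithm applied to $R$ and the blow-up algorithm applied to $\overline{R}$ give the same multiplicity tree, i.e. $T(R)=T(\overline{R})$.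
   Context: For $f=(\phi(t),\psi(u))\in\mathbb{K}[[t]]\times\mathbb{K}[[u]]$ put $\nu(f)=(\mathrm{ord}\,\phi,\mathrm{ord}\,\psi)$, with $\mathrm{ord}\,0=\infty$; vectors are compared componentwise. $\mathbb{K}[[f_1,\ldots,f_n]]$ denotes the closure, in the $(t,u)$-adic topology, of the $\mathbb{K}$-subalgebra (containing $(1,1)$) generated by $f_1,\ldots,f_n$; when all $f_i$ have positive order in both components it is the set of all power series in the $f_i$. The same notation is used in one variable. Generators whose two constant terms are equal and nonzero are always replaced by themselves minus that constant. Two-branch algebroid curve (given by a parametrization): a ring $R=\mathbb{K}[[(\phi_1,\psi_1),\ldots,(\phi_n,\psi_n)]]$ with all $\phi_i,\psi_i$ of positive order, whose integral closure in its total ring of fractions is $\mathbb{K}[[t]]\times\mathbb{K}[[u]]$. It is a local ring. Arf closure: a ring $A\subseteq\mathbb{K}[[t]]\times\mathbb{K}[[u]]$ is Arf if for every $x\in A$ with $\nu(x)=\alpha$ having finite components, $x^{-1}A(\alpha)$ is a ring, where $A(\alpha)=\{r\in A:\nu(r)\ge\alpha\}$. $R^*$ is the smallest Arf ring containing $R$. $\nu(R^* )$ is the set of values in $\mathbb{N}^2$ of elements of $R^*$, and its conductor is the smallest $c\in\mathbb{N}^2$ with $c+\mathbb{N}^2\subseteq\nu(R^* )$. Blow-up algorithm: put $R_1=R$. If $R_m=\mathbb{K}[[y_1,\ldots,y_k]]$ is local (its generators $y_j$ being normalized to have positive order in both components), let $\mathrm{mult}(R_m)$ be the componentwise minimum of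 $\nu(r)$ over $r$ in the maximal ideal of $R_m$, choose $x\in R_m$ with $\nu(x)=\mathrm{mult}(R_m)$, and set $R_{m+1}=\mathbb{K}[[x,y_1/x,\ldots,y_k/x]]$; put $\mathrm{mult}^*(R_m)=\{\mathrm{mult}(R_m)\}$. If $R_m$ is not local, then $R_m=R_m^1\times R_m^2$ with $R_m^1\subseteq\mathbb{K}[[t]]$, $R_m^2\subseteq\mathbb{K}[[u]]$ local; let $m_j$ be the minimal order of elements of the maximal ideal of $R_m^j$, put $\mathrm{mult}^*(R_m)=\{(m_1,0),(0,m_2)\}$, and let $R_{m+1}$ be the product of the blow-ups of the two factors, each computed in one variable by the same formula. The algorithm stops when $\mathrm{mult}^*(R_m)=\{(1,0),(0,1)\}$, i.e. $R_m=\mathbb{K}[[t]]\times\mathbb{K}[[u]]$ (after which the sequence is constant). The resulting rings do not depend on the choices of $x$. Multiplicity tree $T(R)$: the tree whose nodes at level $m$ are the elements of $\mathrm{mult}^*(R_m)$, where a node $v$ at level $m$ and a node $w$ at level $m+1$ are linked if and only if their standard scalar product is nonzero. The same algorithm and definition are applied to $\overline{R}$. *)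

(* Defs.v *)
From HB Require Import structures.
From mathcomp Require Import all_boot all_order all_algebra.
From mathcomp Require Import boolp classical_sets functions cardinality.

Set Implicit Arguments.
Unset Strict Implicit.
Unset Printing Implicit Defensive.

Import GRing.Theory.
Local Open Scope classical_set_scope.
Local Open Scope ring_scope.

(* f n is the coefficient of t^n; the product is the Cauchy product, not the
   pointwise one. *)
Definition fps (K : fieldType) : Type := nat -> K.

HB.instance Definition _ (K : fieldType) := Choice.copy (fps K) (nat -> K).
HB.instance Definition _ (K : fieldType) :=
  GRing.Zmodule.copy (fps K) (nat -> K).

Section FpsRing.
Variable K : fieldType.
Implicit Types (f g h : fps K) (a b : K).

Definition fps_const a : fps K := fun n => if n is 0 then a else 0.

Definition fps_mul f g : fps K := fun n => \sum_(i < n.+1) f i * g (n - i)%N.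

Definition fps_scale a f : fps K := fun n => a * f n.

Lemma fps_mulE f g n :
  fps_mul f g n = \sum_(i < n.+1) f i * g (n - i)%N.
Proof. by []. Qed.

Lemma fpsD f g n : (f + g) n = f n + g n. Proof. by []. Qed.

Lemma fps_mulC : commutative fps_mul.
Proof.
move=> f g; apply/funext => n; rewrite /fps_mul (reindex_inj rev_ord_inj) /=.
by apply: eq_bigr => i _; rewrite subSS (sub_ordK i) mulrC.
Qed.

Lemma fps_mulA : associative fps_mul.
Proof.
move=> f g h; apply/funext => n.
rewrite fps_mulE.
pose coef3 j k := f j * (g (n - j - k)%N * h k).
transitivity (\sum_(j < n.+1) \sum_(k < n.+1 | (k <= n - j)%N) coef3 j k).
  apply: eq_bigr => /= j _; rewrite fps_mulC fps_mulE big_distrr /=.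
  rewrite (big_ord_narrow_leq (leq_subr _ _)) /=.
  by apply: eq_bigr => k _; rewrite /coef3 (mulrC (h k)).
rewrite (exchange_big_dep predT) //= fps_mulC fps_mulE; apply: eq_bigr => k _.
transitivity (\sum_(j < n.+1 | (j <= n - k)%N) coef3 j k).
  apply: eq_bigl => j; rewrite -ltnS -(ltnS j) -!subSn ?leq_ord //.
  by rewrite -subn_gt0 -(subn_gt0 j) -!subnDA addnC.
rewrite (big_ord_narrow_leq (leq_subr _ _)) fps_mulE big_distrr /=.
by apply: eq_bigr => j _; rewrite /coef3 -!subnDA addnC mulrA mulrC.
Qed.

Lemma fps_mul1 : left_id (fps_const 1) fps_mul.
Proof.
move=> f; apply/funext => n; rewrite /fps_mul big_ord_recl /= mul1r subn0.
by rewrite big1 ?addr0 // => i _; rewrite mul0r.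
Qed.

Lemma fps_mulDl : left_distributive fps_mul +%R.
Proof.
move=> f g h; apply/funext => n; rewrite fpsD /fps_mul -big_split /=.
by apply: eq_bigr => i _; rewrite fpsD mulrDl.
Qed.

Lemma fps1_neq0 : fps_const 1 != 0.
Proof. by apply/eqP => /(congr1 (@^~ 0%N))/eqP; apply/negP; exact: oner_neq0. Qed.

HB.instance Definition _ := GRing.Zmodule_isComNzRing.Build (fps K)
  fps_mulA fps_mulC fps_mul1 fps_mulDl fps1_neq0.

Lemma fps_scaleA a b f : fps_scale a (fps_scale b f) = fps_scale (a * b) f.
Proof. by apply/funext => n; rewrite /fps_scale mulrA. Qed.

Lemma fps_scale1 : left_id 1 fps_scale.
Proof. by move=> f; apply/funext => n; rewrite /fps_scale mul1r. Qed.

Lemma fps_scaleDr : right_distributive fps_scale +%R.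
Proof. by move=> a f g; apply/funext => n; rewrite /fps_scale !fpsD mulrDr. Qed.

Lemma fps_scaleDl f : {morph fps_scale^~ f : a b / a + b}.
Proof. by move=> a b; apply/funext => n; rewrite /fps_scale !fpsD mulrDl. Qed.

HB.instance Definition _ := GRing.Zmodule_isLmodule.Build K (fps K)
  fps_scaleA fps_scale1 fps_scaleDr fps_scaleDl.

Lemma fps_scaleAl a f g : a *: (f * g) = (a *: f) * g.
Proof.
apply/funext => n.
change (a * fps_mul f g n = fps_mul (fps_scale a f) g n).
rewrite !fps_mulE big_distrr /=.
by apply: eq_bigr => i _; rewrite mulrA.
Qed.

HB.instance Definition _ := GRing.Lmodule_isLalgebra.Build K (fps K)
  fps_scaleAl.
HB.instance Definition _ := GRing.Lalgebra_isComAlgebra.Build K (fps K).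

Definition fpsX : fps K := fun n => (n == 1%N)%:R.

Definition fps_trunc (d : nat) f : fps K :=
  fun n => if (n <= d)%N then f n else 0.

(* None is the order of 0, namely infinity. *)
Definition ord f : option nat :=
  if pselect (exists n, f n != 0) is left nz_f then Some (ex_minn nz_f)
  else None.

End FpsRing.

Notation fps2 K := (fps K * fps K)%type.

Definition le_ext (m : nat) (o : option nat) : bool :=
  if o is Some n then (m <= n)%N else true.

Section Values.
Variable K : fieldType.
Implicit Types (f : fps2 K) (a : nat * nat).

Definition nu f : option nat * option nat := (ord f.1, ord f.2).

Definition nu_is f a := nu f = (Some a.1, Some a.2).

Definition nu_ge f a := le_ext a.1 (nu f).1 /\ le_ext a.2 (nu f).2.

Definition values (A : set (fps2 K)) : set (nat * nat) :=
  [set a | exists2 f, A f & nu_is f a].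

End Values.

Definition is_conductor (V : set (nat * nat)) (c : nat * nat) :=
  (forall d, V (c + d)) /\
  (forall c' : nat * nat, (forall d, V (c' + d)) ->
     (c.1 <= c'.1)%N /\ (c.2 <= c'.2)%N).

Section Closure.
Variables (K : fieldType) (A : comAlgType K).

Definition adic_closure (pi : A) (B : set A) : set A :=
  [set f | forall N, exists2 g, B g & exists h, f - g = pi ^+ N * h].

Definition gen_subalg (G : set A) : set A :=
  smallest (fun B : set A => GRing.subalg_closed [in B]) G.

Definition psalg (pi : A) (G : set A) : set A := adic_closure pi (gen_subalg G).

End Closure.

Definition psalg1 (K : fieldType) : set (fps K) -> set (fps K) :=
  psalg (fpsX K).
Definition psalg2 (K : fieldType) : set (fps2 K) -> set (fps2 K) :=
  psalg ((fpsX K, fpsX K) : fps2 K).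

Section Subrings.
Variables (A : comNzRingType) (R : set A).

Definition is_ideal (I : set A) :=
  [/\ I `<=` R, I 0, (forall x y, I x -> I y -> I (x + y))
    & forall r x, R r -> I x -> I (r * x)].

Definition maximal_ideal (M : set A) :=
  [/\ is_ideal M, M <> R
    & forall J, is_ideal J -> M `<=` J -> J = M \/ J = R].

Definition is_local := exists! M, maximal_ideal M.

Definition regular_in (b : A) := R b /\ forall a, R a -> a * b = 0 -> a = 0.

(* Q, with the restriction of i to R, is the total ring of fractions of R. *)
Definition is_total_fractions (Q : comUnitRingType) (i : {rmorphism A -> Q}) :=
  [/\ {in R &, injective i},
      forall b, regular_in b -> i b \is a GRing.unit
    & forall q, exists a b, [/\ R a, regular_in b & q = i a / i b]].

Definition integral_over (Q : comUnitRingType) (i : {rmorphism A -> Q}) (q : Q) :=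
  exists2 p : {poly Q}, p \is monic &
    (forall k, exists2 r, R r & p`_k = i r) /\ root p q.

(* The overring A of R embeds, over R, in the total ring of fractions of R, and
   its image is the integral closure of R there. *)
Definition integral_closure_is_full :=
  exists (Q : comUnitRingType) (i : {rmorphism A -> Q}),
    [/\ is_total_fractions i, injective i
      & forall q, integral_over i q <-> exists s, q = i s].

End Subrings.

Section Curve.
Variables (K : fieldType) (n : nat).

Definition curve_ring (phi psi : 'I_n -> fps K) : set (fps2 K) :=
  psalg2 (range (fun i => (phi i, psi i))).

Definition is_two_branch_curve (phi psi : 'I_n -> fps K) :=
  (forall i, nu_ge (phi i, psi i) (1, 1)%N) /\
  integral_closure_is_full (curve_ring phi psi).

End Curve.

Section Arf.
Variable K : fieldType.
Implicit Types A R : set (fps2 K).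

Definition is_subring A := GRing.subring_closed [in A].

Definition ge_part A (alpha : nat * nat) : set (fps2 K) :=
  [set r | A r /\ nu_ge r alpha].

(* When nu x = alpha is finite, x is regular and divides every element of value
   at least alpha, so the set below is x^-1 A(alpha). *)
Definition is_arf A :=
  is_subring A /\
  forall x alpha, A x -> nu_is x alpha ->
    is_subring [set s | exists2 r, ge_part A alpha r & x * s = r].

Definition arf_closure R : set (fps2 K) := smallest is_arf R.

End Arf.

Section BlowUp.
Variable K : fieldType.

(* The y_j / x are the z_j with x z_j = y_j; they are unique because, in all
   uses below, x has finite order(s). *)
Definition quotients (A : comAlgType K) k (x : A) (y z : 'I_k -> A) :=
  forall j, x * z j = y j.

Definition is_mult1 (R : set (fps K)) (m : nat) :=
  exists M, [/\ maximal_ideal R M, exists2 r, M r & ord r = Some m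
    & forall r, M r -> le_ext m (ord r)].

Definition is_blowup1 (R R' : set (fps K)) :=
  exists (k : nat) (y z : 'I_k -> fps K) (x : fps K) (m : nat),
    [/\ R = psalg1 (range y), (forall j, le_ext 1 (ord (y j))),
        [/\ is_mult1 R m, R x & ord x = Some m],
        quotients x y z & R' = psalg1 ([set x] `|` range z)].

Definition is_mult2 (R : set (fps2 K)) (a : nat * nat) :=
  exists M, [/\ maximal_ideal R M,
      exists2 r, M r & ord r.1 = Some a.1,
      exists2 r, M r & ord r.2 = Some a.2
    & forall r, M r -> nu_ge r a].

Definition is_blowup2 (R R' : set (fps2 K)) :=
  exists (k : nat) (y z : 'I_k -> fps2 K) (x : fps2 K) (a : nat * nat),
    [/\ R = psalg2 (range y), (forall j, nu_ge (y j) (1, 1)%N),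
        [/\ is_mult2 R a, R x & nu_is x a],
        quotients x y z & R' = psalg2 ([set x] `|` range z)].

Definition splits (R : set (fps2 K)) (R1 R2 : set (fps K)) :=
  [/\ R = R1 `*` R2, is_local R1 & is_local R2].

Definition is_blowup (R R' : set (fps2 K)) :=
  (is_local R /\ is_blowup2 R R') \/
  (~ is_local R /\ exists R1 R2 R1' R2',
     [/\ splits R R1 R2, is_blowup1 R1 R1', is_blowup1 R2 R2'
       & R' = R1' `*` R2']).

(* For R = K[[y_1, ..., y_k]] over an infinite field, is_blowup determines R'
   from R, and R' exists unless some multiplicity is infinite. The default set0
   is not a ring and contributes no node to the multiplicity tree. *)
Definition blowup (R : set (fps2 K)) : set (fps2 K) := xget set0 (is_blowup R).

Definition mult_star (R : set (fps2 K)) : set (nat * nat) :=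
  [set v | (is_local R /\ is_mult2 R v) \/
    (~ is_local R /\ exists R1 R2 m1 m2,
       [/\ splits R R1 R2, is_mult1 R1 m1, is_mult1 R2 m2
         & v = (m1, 0%N) \/ v = (0%N, m2)])].

(* Indices start at 0. No stopping rule is needed: K[[t]] x K[[u]] is its own
   blow-up. *)
Definition blowup_seq (R : set (fps2 K)) (m : nat) := iter m blowup R.

(* A node is a pair (level, vector). *)
Record multiplicity_tree := MultiplicityTree {
  tree_node : set (nat * (nat * nat));
  tree_link : set ((nat * (nat * nat)) * (nat * (nat * nat))) }.

Definition mult_tree (R : set (fps2 K)) : multiplicity_tree :=
  let node := [set p | mult_star (blowup_seq R p.1) p.2] in
  MultiplicityTree node
    [set pq | [/\ node pq.1, node pq.2, pq.2.1 = pq.1.1.+1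
      & (pq.1.2.1 * pq.2.2.1 + pq.1.2.2 * pq.2.2.2)%N <> 0%N]].

End BlowUp.

(* Main.v *)
Require Import Defs.
From mathcomp Require Import all_boot all_order all_algebra.
From mathcomp Require Import boolp classical_sets functions cardinality.
From mathcomp Require Import zify ring.

(** If [R = K[[y_1,...,y_k]]] is local and [x] has minimal value [e], its blow-up
    [R' = K[[x, y_j/x]]] satisfies [R <= K + x R']. If [A] is an Arf ring
    containing [R'], then [K + x A] is an Arf ring containing [R], and its nonzero
    values are those of [A] translated by [e]. So if every Arf ring containing [R]
    has [c + N^2] among its values, then [e <= c] and every Arf ring containing
    [R'] has [c - e + N^2] among its values. A blow-up of generators known modulo
    [(t^(c1+2), u^(c2+2))] costs [e] in precision, which is exactly what [c]
    loses: the generators of the two rings keep agreeing to order [c + 2], enough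
    to have the same minimal values and to detect whether the ring splits. After
    the splitting each branch goes on alone; once its component of [c] is [0]
    its multiplicity is [1] and stays so. *)

Set Implicit Arguments.
Unset Strict Implicit.
Unset Printing Implicit Defensive.

Import GRing.Theory.
Local Open Scope classical_set_scope.
Local Open Scope ring_scope.

(** * Subalgebras and adic closures *)

(** The two extra orders of precision are what the end of the process demands: when a component of
    the bound has dropped to 0, an element of order 1 must still be visible, so the coefficients of
    degree 0 and 1 must be known. Before the splitting [e <= c] holds in both components, so every
    quotient is known to order [c - e + 2 >= 2] in each branch. Its constant terms are therefore
    known, and they alone decide the splitting: a generator with two different constant terms has
    the idempotent [(1, 0)] as a limit of polynomials in it, while equal constant terms can be
    subtracted.

    The bound is carried for the first ring only. The second is controlled through the agreement of
    its generators, so nothing has to be known about its Arf closure.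

    Since [blowup] is a choice among rings, a computed blow-up is usable only after independence
    from the minimal element and from the generators is shown. This and the Arf property of
    [K + x A] are proved once for [K[[t]]] and [K[[t]] x K[[u]]], with divisibility in place of
    orders. *)

Definition divides (A : comNzRingType) (x f : A) := exists h, f = x * h.

Section Divides.
Variable A : comNzRingType.
Implicit Types x f g : A.

Lemma dividesxx x : divides x x. Proof. by exists 1; rewrite mulr1. Qed.

Lemma divides0 x : divides x 0. Proof. by exists 0; rewrite mulr0. Qed.

Lemma dividesMr x f g : divides x f -> divides x (f * g).
Proof. by move=> [h ->]; exists (h * g); rewrite mulrA. Qed.

Lemma dividesMl x f g : divides x f -> divides x (g * f).
Proof. by rewrite mulrC; exact: dividesMr. Qed.

Lemma dividesD x f g : divides x f -> divides x g -> divides x (f + g).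
Proof. by move=> [h ->] [k ->]; exists (h + k); rewrite mulrDr. Qed.

Lemma dividesB x f g : divides x f -> divides x g -> divides x (f - g).
Proof. by move=> [h ->] [k ->]; exists (h - k); rewrite mulrBr. Qed.

End Divides.

Definition subalgebra (K : fieldType) (A : comAlgType K) (B : set A) :=
  [/\ B 1, forall a f g, B f -> B g -> B (a *: f + g)
    & forall f g, B f -> B g -> B (f * g)].

Definition subring (A : comNzRingType) (B : set A) :=
  [/\ B 1, forall f g, B f -> B g -> B (f - g)
    & forall f g, B f -> B g -> B (f * g)].

Section Subalgebra.
Variables (K : fieldType) (A : comAlgType K).
Implicit Types (B G : set A).

Lemma subalg_closedP B : GRing.subalg_closed [in B] <-> subalgebra B.
Proof.
split=> -[B1 BD BM]; split.
- by move: B1; rewrite inE.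
- by move=> a f g Bf Bg; have := BD a f g; rewrite !inE; apply.
- by move=> f g Bf Bg; have := BM f g; rewrite !inE; apply.
- by rewrite inE.
- by move=> a f g; rewrite !inE; exact: BD.
- by move=> f g; rewrite !inE; exact: BM.
Qed.

Lemma subring_closedP B : GRing.subring_closed [in B] <-> subring B.
Proof.
split=> -[B1 BB BM]; split.
- by move: B1; rewrite inE.
- by move=> f g Bf Bg; have := BB f g; rewrite !inE; apply.
- by move=> f g Bf Bg; have := BM f g; rewrite !inE; apply.
- by rewrite inE.
- by move=> f g; rewrite !inE; exact: BB.
- by move=> f g; rewrite !inE; exact: BM.
Qed.

Lemma subring0 B : subring B -> B 0.
Proof. by move=> [B1 BB _]; rewrite -(subrr 1); exact: BB. Qed.

Lemma subringD B f g : subring B -> B f -> B g -> B (f + g).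
Proof.
move=> Bs Bf Bg; have [B1 BB _] := Bs.
by rewrite -[g]opprK -[- g]sub0r; apply/BB/BB => //; exact: subring0.
Qed.

Lemma subringX B f n : subring B -> B f -> B (f ^+ n).
Proof.
move=> [B1 _ BM] Bf; elim: n => [|n IHn]; first by rewrite expr0.
by rewrite exprS; exact: BM.
Qed.

Lemma subalgebra_subring B : subalgebra B -> subring B.
Proof.
move=> [B1 BD BM]; split=> // f g Bf Bg.
by have := BD (-1) g f Bg Bf; rewrite scaleN1r addrC.
Qed.

Lemma subalgebra_const B a : subalgebra B -> B a%:A.
Proof.
move=> Bs; have [B1 BD _] := Bs.
by rewrite -[_%:A]addr0; apply: BD => //; exact: subring0 (subalgebra_subring Bs).
Qed.

Lemma gen_subalg_subalgebra G : subalgebra (gen_subalg G).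
Proof.
split.
- by move=> B [/subalg_closedP[]].
- move=> a f g Gf Gg B BG; have [/subalg_closedP[_ BD _] _] := BG.
  by apply: BD; [exact: Gf | exact: Gg].
- move=> f g Gf Gg B BG; have [/subalg_closedP[_ _ BM] _] := BG.
  by apply: BM; [exact: Gf | exact: Gg].
Qed.

Lemma gen_subalg_min B G : subalgebra B -> G `<=` B -> gen_subalg G `<=` B.
Proof. by move=> Bs GB; apply: smallest_sub => //; exact/subalg_closedP. Qed.

End Subalgebra.

Definition adic_closed (K : fieldType) (A : comAlgType K) (pi : A) (B : set A) :=
  adic_closure pi B `<=` B.

Section Psalg.
Variables (K : fieldType) (A : comAlgType K) (pi : A).
Implicit Types (B G : set A).

Lemma sub_adic_closure B : B `<=` adic_closure pi B.
Proof. by move=> f Bf N; exists f => //; exists 0; rewrite subrr mulr0. Qed.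

Lemma adic_closure_subalgebra B : subalgebra B -> subalgebra (adic_closure pi B).
Proof.
move=> [B1 BD BM]; split; first exact: sub_adic_closure.
- move=> a f g Bf Bg N; have [f' Bf' [h fE]] := Bf N; have [g' Bg' [k gE]] := Bg N.
  exists (a *: f' + g'); first exact: BD.
  exists (a *: h + k); rewrite mulrDr -gE -scalerAr -fE scalerBr.
  by rewrite opprD addrACA.
- move=> f g Bf Bg N; have [f' Bf' [h fE]] := Bf N; have [g' Bg' [k gE]] := Bg N.
  exists (f' * g'); first exact: BM.
  exists (h * g + f' * k); rewrite mulrDr mulrA -fE mulrCA -gE; ring.
Qed.

Lemma psalg_subalgebra G : subalgebra (psalg pi G).
Proof. exact/adic_closure_subalgebra/gen_subalg_subalgebra. Qed.

Lemma psalg_closed G : adic_closed pi (psalg pi G).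
Proof.
move=> f Gf N; have [g Gg [h fE]] := Gf N; have [g' Gg' [h' gE]] := Gg N.
by exists g' => //; exists (h + h'); rewrite mulrDr -fE -gE; ring.
Qed.

Lemma sub_psalg G : G `<=` psalg pi G.
Proof. by move=> f Gf; apply: sub_adic_closure => B [_]; exact. Qed.

Lemma psalg_min B G :
  subalgebra B -> adic_closed pi B -> G `<=` B -> psalg pi G `<=` B.
Proof.
move=> Bs Bc GB f Gf; apply: Bc => N; have [g Gg gE] := Gf N.
by exists g => //; exact: gen_subalg_min GB _ Gg.
Qed.

Lemma eq_psalg G G' :
  G `<=` psalg pi G' -> G' `<=` psalg pi G -> psalg pi G = psalg pi G'.
Proof.
by move=> GG' G'G; apply/seteqP; split; apply: psalg_min => //;
  (exact: psalg_subalgebra || exact: psalg_closed).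
Qed.

End Psalg.

Definition const_plus (K : fieldType) (A : comAlgType K) (x : A) (B : set A) :
  set A := [set f | exists a, exists2 b, B b & f = a%:A + x * b].

Section ConstPlus.
Variables (K : fieldType) (A : comAlgType K).
Implicit Types (x : A) (B : set A).

Lemma const_plus_subalgebra x B : subalgebra B -> B x ->
  subalgebra (const_plus x B).
Proof.
move=> Bs Bx; have [B1 BD BM] := Bs; have B0 := subring0 (subalgebra_subring Bs).
split.
- by exists 1, 0 => //; rewrite mulr0 addr0 scale1r.
- move=> c _ _ [a [f Bf ->]] [b [g Bg ->]].
  exists (c * a + b), (c *: f + g); first exact: BD.
  by rewrite scalerDr scalerA mulrDr scalerDl -scalerAr addrACA.
- move=> _ _ [a [f Bf ->]] [b [g Bg ->]].
  exists (a * b), (a *: g + (b *: f + x * (f * g))).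
    by apply/BD/BD => //; apply/BM/BM.
  rewrite mulrDl !mulrDr !mulr_algl [x * f * _]mulrC mulr_algl scalerA.
  by rewrite -!scalerAr -addrA mulrACA -[x * x * _]mulrA.
Qed.

Lemma const_plus_subring x B : subring B -> (forall a, B a%:A) -> B x ->
  subring (const_plus x B).
Proof.
move=> Bs Bc Bx.
have Bsa : subalgebra B.
  have [B1 BB BM] := Bs; split=> // a f g Bf Bg.
  by apply: subringD => //; rewrite -mulr_algl; exact: BM.
exact/subalgebra_subring/const_plus_subalgebra.
Qed.

End ConstPlus.

(** * Blow-ups and Arf rings in an adic algebra *)

(* Covers [K[[t]]] and [K[[t]] x K[[u]]]; the last field says that a unit [w] is
   invertible modulo [pi] inside every subalgebra containing it. *)
Record adic_algebra (K : fieldType) (A : comAlgType K) (pi : A) : Prop :=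
  AdicAlgebra {
  adic_regular : forall f, pi * f = 0 -> f = 0;
  adic_const : forall a : K, divides pi a%:A -> a = 0;
  adic_inv1 : forall h, exists u, (1 - pi * h) * u = 1;
  adic_inv : forall B w u, subalgebra B -> B w -> w * u = 1 ->
    exists2 v, B v & divides pi (1 - w * v) }.

(** An order-free way to say that every component of [x] has finite order. Such an [x] can be
    cancelled, and dividing by it loses only finitely many orders. *)
Definition finite_value (K : fieldType) (A : comAlgType K) (pi x : A) :=
  exists N, divides x (pi ^+ N).

Section AdicAlgebra.
Variables (K : fieldType) (A : comAlgType K) (pi : A).
Hypothesis piP : adic_algebra pi.
Implicit Types (x f g : A) (B R M : set A).

Lemma finite_value_regular x f : finite_value pi x -> x * f = 0 -> f = 0.
Proof.
move=> [N [g piN]] xf0.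
have : pi ^+ N * f = 0 by rewrite piN mulrAC xf0 mul0r.
elim: N {piN} => [|N IHN]; first by rewrite expr0 mul1r.
by rewrite exprS -mulrA => /(adic_regular piP).
Qed.

Lemma finite_value_inj x f g : finite_value pi x -> x * f = x * g -> f = g.
Proof.
move=> xfin xfg; apply/eqP; rewrite -subr_eq0; apply/eqP.
by apply: (finite_value_regular xfin); rewrite mulrBr xfg subrr.
Qed.

(** An inverse modulo [pi] found in [R] is corrected by a geometric series, which converges in [R]
    because [R] is closed. *)
Lemma adic_inv_in R w u :
  subalgebra R -> adic_closed pi R -> R w -> w * u = 1 -> R u.
Proof.
move=> Rs Rc Rw wu; have Rr := subalgebra_subring Rs; have [R1 RB RM] := Rr.
have [v Rv [h vE]] := adic_inv piP Rs Rw wu.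
have [u' u'E] := adic_inv1 piP h.
have -> : u = v * u'.
  have <- : (w * u) * (v * u') = v * u' by rewrite wu mul1r.
  have -> : w * u * (v * u') = u * (w * v) * u' by ring.
  have -> : w * v = 1 - pi * h by rewrite -vE; ring.
  by rewrite -mulrA u'E mulr1.
apply: (RM) => //; apply: Rc => N.
exists (\sum_(i < N) (pi * h) ^+ i).
  have Rm : R (pi * h) by rewrite -vE; apply: RB => //; exact: RM.
  elim: N => [|N IHN]; first by rewrite big_ord0; exact: subring0.
  rewrite big_ord_recr /=; apply: (subringD Rr IHN).
  exact: (subringX _ Rr Rm).
exists (h ^+ N * u').
have geo := subrX1 (pi * h) N.
set S := \sum_(i < N) _ in geo *.
have -> : u' - S = u' * (1 - (1 - pi * h) * S).
  by rewrite mulrBr mulr1 mulrA [u' * _]mulrC u'E mul1r.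
have -> : 1 - (1 - pi * h) * S = (pi * h) ^+ N.
  have -> : 1 - (1 - pi * h) * S = 1 + (pi * h - 1) * S by ring.
  by rewrite -geo addrC subrK.
by rewrite exprMn mulrC mulrA.
Qed.

(** All approximants of [f] share one constant because [pi] divides [x]. As [x] divides [pi ^+ N0],
    knowing [f] to order [N0 + N] gives the factor of [x] to order [N]. *)
Lemma const_plus_closed x B :
  finite_value pi x -> divides pi x -> adic_closed pi B ->
  adic_closed pi (const_plus x B).
Proof.
move=> [N0 [g piN0]] [y xE] Bc f Bf.
have [_ [a1 [b1 _ ->]] [h1 fE1]] := Bf 1%N.
have fE N : exists2 b, B b & exists h, f - a1%:A - x * b = pi ^+ N * h.
  (* Order [N.+1] keeps the error divisible by [pi] even for [N = 0], so that [a2] can be compared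
     with [a1]. *)
  have [_ [a2 [b2 Bb2 ->]] [h2 fE2]] := Bf N.+1.
  have /eqP : a2 - a1 = 0.
    apply: (adic_const piP); exists (h1 + y * b1 - y * b2 - pi ^+ N * h2).
    rewrite scalerBl !mulrBr !mulrDr !mulrA -xE -exprS -fE2.
    rewrite expr1 in fE1; rewrite -fE1; ring.
  rewrite subr_eq0 => /eqP a12; exists b2 => //; exists (pi * h2).
  by rewrite mulrA -exprSr -fE2 a12 opprD addrA.
have [b0 _ [h0 f0E]] := fE N0.
exists a1, (b0 + g * h0); last first.
  by rewrite mulrDr mulrA -piN0 -f0E; ring.
apply: Bc => N; have [b Bb [h bE]] := fE (N0 + N)%N.
exists b => //; exists (g * h); apply: (@finite_value_inj x).
  by exists N0, g.
rewrite mulrBr mulrDr [x * (g * h0)]mulrA -piN0 -f0E.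
have -> : x * (pi ^+ N * (g * h)) = pi ^+ N0 * pi ^+ N * h by rewrite piN0; ring.
by rewrite -exprD -bE; ring.
Qed.

Lemma finite_value_pi : finite_value pi pi.
Proof. by exists 1%N, 1; rewrite expr1 mulr1. Qed.

Lemma const_plus_psalg k x (y z : 'I_k -> A) :
  finite_value pi x -> divides pi x -> quotients x y z ->
  psalg pi (range y) `<=` const_plus x (psalg pi ([set x] `|` range z)).
Proof.
move=> xfin pix xz.
have R's := psalg_subalgebra pi ([set x] `|` range z).
apply: psalg_min.
- by apply: const_plus_subalgebra => //; apply: sub_psalg; left.
- by apply: const_plus_closed => //; exact: psalg_closed.
- move=> _ [j _ <-]; exists 0, (z j); first by apply: sub_psalg; right; exists j.
  by rewrite scale0r add0r xz.
Qed.

Definition positive_part R := R `&` divides pi.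

(** The last condition makes every element a constant modulo [pi]. For pairs this means equal
    constant terms, so products of branches are excluded; the ring is then local with maximal ideal
    [positive_part R]. *)
Definition pointed R :=
  [/\ subalgebra R, adic_closed pi R & R `<=` const_plus pi setT].

Lemma psalg_pointed k (y : 'I_k -> A) :
  (forall j, divides pi (y j)) -> pointed (psalg pi (range y)).
Proof.
move=> ypos; split; [exact: psalg_subalgebra | exact: psalg_closed|].
apply: psalg_min; first exact: const_plus_subalgebra.
  apply: const_plus_closed => //; [exact: finite_value_pi | exact: dividesxx].
by move=> _ [j _ <-]; have [h ->] := ypos j; exists 0, h; rewrite ?scale0r ?add0r.
Qed.

Lemma pointed_unit R r : pointed R -> R r -> ~ divides pi r ->
  exists2 s, R s & r * s = 1.
Proof.
move=> [Rs Rc Rp] Rr rN; have [a [h _ rE]] := Rp _ Rr.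
have a0 : a != 0.
  by apply/eqP => a0; apply: rN; exists h; rewrite rE a0 scale0r add0r.
have [u uE] := adic_inv1 piP (- (a^-1 *: h)).
exists (a^-1 *: u).
  apply: (adic_inv_in Rs Rc Rr); rewrite -uE rE mulrN opprK.
  by rewrite -!scalerAr scalerAl scalerDr scalerA mulVf // scale1r.
rewrite -uE rE mulrN opprK.
by rewrite -!scalerAr scalerAl scalerDr scalerA mulVf // scale1r.
Qed.

Lemma not_divides1 : ~ divides pi 1.
Proof.
move=> pi1; have /eqP : 1 = 0 :> K by apply: (adic_const piP); rewrite scale1r.
by rewrite oner_eq0.
Qed.

Lemma ideal_pointed R M : pointed R -> is_ideal R M -> M <> R ->
  M `<=` positive_part R.
Proof.
move=> Rp [MR M0 MD MM] MNR r Mr; split; first exact: MR.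
apply: contrapT => rN; apply: MNR; apply/seteqP; split => // s Rs.
have [v Rv rv] := pointed_unit Rp (MR _ Mr) rN.
have [[_ _ RM] _ _] := Rp.
have -> : s = s * v * r by rewrite -mulrA [v * r]mulrC rv mulr1.
by apply: MM => //; exact: RM.
Qed.

Lemma positive_part_ideal R : pointed R -> is_ideal R (positive_part R).
Proof.
move=> [Rs _ _]; have Rr := subalgebra_subring Rs; split.
- by move=> r [].
- by split; [exact: subring0 | exact: divides0].
- move=> r s [Rr' pr] [Rs' ps]; split; [exact: subringD | exact: dividesD].
- by move=> r s Rr' [Rs' ps]; case: Rs => _ _ RM; split;
    [exact: RM | exact: dividesMl].
Qed.

Lemma positive_part_neq R : pointed R -> positive_part R <> R.
Proof.
move=> [[R1 _ _] _ _] RE; apply: not_divides1.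
by move: R1; rewrite -RE => -[].
Qed.

Lemma pointed_maximal R M :
  pointed R -> maximal_ideal R M <-> M = positive_part R.
Proof.
move=> Rp; split=> [[Mi MNR Mmax]|->].
  have [] := Mmax _ (positive_part_ideal Rp) (ideal_pointed Rp Mi MNR) => //.
  by move=> /(positive_part_neq Rp).
split; [exact: positive_part_ideal | exact: positive_part_neq |].
move=> J Ji RJ; case: (pselect (J = R)) => [|JNR]; first by right.
by left; apply/seteqP; split=> //; exact: ideal_pointed.
Qed.

Lemma pointed_local R : pointed R -> is_local R.
Proof.
move=> Rp; exists (positive_part R); split; first exact/pointed_maximal.
by move=> M /(pointed_maximal _ Rp).
Qed.

(** Modulo [pi] the constant in [K + x R'] must vanish. Hence [x] divides the whole maximal ideal,
    which makes its value minimal, and the quotients stay in the blow-up. *)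
Lemma positive_part_sub k x (y z : 'I_k -> A) :
  finite_value pi x -> divides pi x -> quotients x y z ->
  forall r, positive_part (psalg pi (range y)) r ->
  exists2 w, psalg pi ([set x] `|` range z) w & r = x * w.
Proof.
move=> xfin pix xz r [Rr pir].
have [a [w R'w rE]] := const_plus_psalg xfin pix xz Rr.
exists w => //; rewrite rE (_ : a = 0) ?scale0r ?add0r //.
apply: (adic_const piP); have -> : a%:A = r - x * w by rewrite rE addrK.
by apply: dividesB => //; exact: dividesMr.
Qed.

(* If x, x' are two choices of a minimal element, each divides the other inside
   the blow-up made with it, so x' = x w with w a unit of that blow-up. *)
Lemma sub_psalg_quotients k k' x x' (y z : 'I_k -> A) (y' z' : 'I_k' -> A) :
  psalg pi (range y) = psalg pi (range y') ->
  (forall j, divides pi (y' j)) ->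
  psalg pi (range y) x -> psalg pi (range y') x' ->
  finite_value pi x -> divides pi x -> finite_value pi x' -> divides pi x' ->
  quotients x y z -> quotients x' y' z' ->
  psalg pi ([set x'] `|` range z') `<=` psalg pi ([set x] `|` range z).
Proof.
move=> RE pos' Rx Rx' xfin pix x'fin pix' xz xz'.
have [R's R'c] := (psalg_subalgebra pi ([set x] `|` range z),
  @psalg_closed _ _ pi ([set x] `|` range z)).
have [_ _ R'M] := R's.
have Rsub := positive_part_sub xfin pix xz.
have [|w R'w x'E] := Rsub x'; first by split => //; rewrite RE.
have [|w' _ xE] := positive_part_sub x'fin pix' xz' (r := x).
  by split => //; rewrite -RE.
have R'w' : psalg pi ([set x] `|` range z) w'.
  apply: adic_inv_in R'w _ => //; apply: (finite_value_inj xfin).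
  by rewrite mulr1 mulrA -x'E -xE.
have R'x : psalg pi ([set x] `|` range z) x by apply: sub_psalg; left.
apply: psalg_min => // f [->|[j _ <-]]; first by rewrite x'E; exact: R'M.
have [|v R'v y'E] := Rsub (y' j).
  by split => //; rewrite RE; apply: sub_psalg; exists j.
have -> : z' j = w' * v; last exact: R'M.
by apply: (finite_value_inj x'fin); rewrite xz' y'E mulrA -xE.
Qed.

Lemma eq_psalg_quotients k k' x x' (y z : 'I_k -> A) (y' z' : 'I_k' -> A) :
  psalg pi (range y) = psalg pi (range y') ->
  (forall j, divides pi (y j)) -> (forall j, divides pi (y' j)) ->
  psalg pi (range y) x -> psalg pi (range y') x' ->
  finite_value pi x -> divides pi x -> finite_value pi x' -> divides pi x' ->
  quotients x y z -> quotients x' y' z' ->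
  psalg pi ([set x] `|` range z) = psalg pi ([set x'] `|` range z').
Proof.
move=> RE pos pos' Rx Rx' xfin pix x'fin pix' xz xz'; apply/seteqP; split.
  exact: (@sub_psalg_quotients _ _ x' x y' z' y z).
exact: (@sub_psalg_quotients _ _ x x' y z y' z').
Qed.

(** Here [x * s] automatically has value at least that of [x], so the set is [x^-1 B(alpha)] without
    mention of [alpha]. *)
Definition arf_subring B := subring B /\
  forall x, B x -> finite_value pi x -> subring [set s | B (x * s)].

Lemma arf_subringT : arf_subring setT. Proof. by split. Qed.

Lemma finite_value_factor x b : finite_value pi (x * b) -> finite_value pi b.
Proof. by move=> [N [g gE]]; exists N, (x * g); rewrite gE mulrCA mulrA. Qed.

(** [w^-1 B] is a ring containing [u], hence [u^2]; multiplying by [w] gives back [u], now in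
    [B]. *)
Lemma arf_subring_inv B w u : arf_subring B -> B w -> w * u = 1 -> B u.
Proof.
move=> [[B1 _ _] Barf] Bw wu.
have wfin : finite_value pi w by exists 0%N, u; rewrite expr0 wu.
have [_ _ wM] := Barf _ Bw wfin.
have := wM u u; rewrite /= wu mulrA wu mul1r; exact.
Qed.

(** If the constant [a] of [f] is 0, then [f = x b] and the quotient ring at [f] is that of [B] at
    [b]. Otherwise [f] is a unit of [K + x B], and the quotient ring is [K + x B] itself. *)
Lemma arf_const_plus x B : finite_value pi x -> divides pi x ->
  arf_subring B -> (forall a : K, B a%:A) -> B x -> arf_subring (const_plus x B).
Proof.
move=> xfin pix Barf Bc Bx; have [Bs Bq] := Barf; have [B1 BB BM] := Bs.
have Cs := const_plus_subring Bs Bc Bx; split => // f Cf ffin.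
have [a [b Bb fE]] := Cf.
have [a0|a0] := eqVneq a 0.
  have fxb : f = x * b by rewrite fE a0 scale0r add0r.
  have bfin : finite_value pi b by apply: (@finite_value_factor x); rewrite -fxb.
  have -> : [set s | const_plus x B (f * s)] = [set s | B (b * s)].
    apply/seteqP; split=> s /=; last first.
      by move=> Bbs; exists 0, (b * s) => //; rewrite fxb scale0r add0r mulrA.
    move=> [c [d Bd fsE]]; have c0 : c = 0.
      apply: (adic_const piP); have -> : c%:A = x * (b * s - d).
        by rewrite mulrBr mulrA -fxb fsE addrK.
      exact: dividesMr.
    suff -> : b * s = d by [].
    by apply: (finite_value_inj xfin); rewrite mulrA -fxb fsE c0 scale0r add0r.
  exact: Bq.
have [y xE] := pix.
have [u uE] := adic_inv1 piP (- (a^-1 *: (y * b))).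
pose v := a^-1 *: u.
have fv : f * v = 1.
  rewrite -uE fE xE mulrN opprK -!scalerAr scalerAl scalerDr scalerA mulVf //.
  by rewrite scale1r mulrA.
have Bf : B f.
  by rewrite fE; apply: subringD => //; exact: BM.
have Bv := arf_subring_inv Barf Bf fv.
(* Multiplying [f = a + x b] by [v] gives [a v = 1 - x b v], which exhibits the constant [a^-1] of
   [v]. *)
have Cv : const_plus x B v.
  exists a^-1, (- (a^-1)%:A * (b * v)).
    apply: (BM); last exact: BM.
    by rewrite -sub0r; apply: BB => //; exact: subring0.
  have : a *: v = 1 - x * (b * v).
    by rewrite -fv fE mulrDl mulr_algl mulrA addrK.
  move/(congr1 ( *:%R a^-1)); rewrite scalerA mulVf // scale1r => {1}->.
  by rewrite scalerBr mulNr mulr_algl mulrN scalerAr.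
suff -> : [set s | const_plus x B (f * s)] = const_plus x B by [].
have [_ _ CM] := Cs.
apply/seteqP; split=> s /= Hs; last exact: CM.
by rewrite -[s]mul1r -fv [f * v]mulrC -mulrA; exact: CM.
Qed.

End AdicAlgebra.

(** * Power series *)

Section PowerSeries.
Variable K : fieldType.
Implicit Types f g h x w : fps K.
Local Notation X := (fpsX K).

Lemma fpsM f g n : (f * g) n = \sum_(i < n.+1) f i * g (n - i)%N.
Proof. by []. Qed.

Lemma fpsB f g n : (f - g) n = f n - g n. Proof. by []. Qed.

Lemma fpsZ (a : K) f n : (a *: f) n = a * f n. Proof. by []. Qed.

Lemma fps1E n : (1 : fps K) n = (n == 0%N)%:R. Proof. by case: n. Qed.

Lemma fps_coef0M f g : (f * g) 0%N = f 0%N * g 0%N.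
Proof. by rewrite fpsM big_ord_recl big_ord0 addr0. Qed.

Lemma fps_coef0C (a : K) : (a%:A : fps K) 0%N = a.
Proof. by rewrite fpsZ fps1E mulr1. Qed.

Lemma fps_coefXM f n : (X * f) n = if n is n'.+1 then f n' else 0.
Proof.
rewrite fpsM big_ord_recl [X ord0]/fpsX mul0r add0r.
case: n => [|n]; first by rewrite big_ord0.
rewrite big_ord_recl [X _]/fpsX mul1r big1 ?addr0 => [|i _].
  by rewrite /= subSS subn0.
by rewrite [X _]/fpsX mul0r.
Qed.

Lemma fps_coefXnM N f n : (X ^+ N * f) n = if (n < N)%N then 0 else f (n - N)%N.
Proof.
elim: N n => [|N IHN] n; first by rewrite expr0 mul1r subn0.
by rewrite exprS -mulrA fps_coefXM; case: n.
Qed.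

Lemma divides_XnP N f : divides (X ^+ N) f <-> forall n, (n < N)%N -> f n = 0.
Proof.
split=> [[h ->] n nN|f0]; first by rewrite fps_coefXnM nN.
exists (fun n => f (n + N)%N); apply/funext => n.
by rewrite fps_coefXnM; case: ltnP => [/f0//|nN]; rewrite subnK.
Qed.

Lemma divides_XP f : divides X f <-> f 0%N = 0.
Proof.
rewrite -[X]expr1; rewrite divides_XnP; split=> [->//|f0 [|n]] //.
Qed.

(** Each coefficient of the inverse depends on all the earlier ones, so the recursion carries the
    list of the first [n]. *)
Fixpoint inv_coefs f n : seq K :=
  if n is m.+1 then
    let s := inv_coefs f m in
    rcons s ((f 0%N)^-1 * ((m == 0%N)%:R - \sum_(i < m) f i.+1 * s`_(m - i.+1)))
  else [::].

Lemma size_inv_coefs f n : size (inv_coefs f n) = n.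
Proof. by elim: n => //= n IHn; rewrite size_rcons IHn. Qed.

Lemma nth_inv_coefs f m n i : (i < n)%N -> (n <= m)%N ->
  (inv_coefs f m)`_i = (inv_coefs f n)`_i.
Proof.
move=> iN; elim: m => [|m IHm]; first by case: n iN.
rewrite leq_eqVlt => /orP[/eqP->//|nm].
by rewrite -IHm //= nth_rcons size_inv_coefs (leq_trans iN).
Qed.

Lemma fps_inv f : f 0%N != 0 -> exists g, f * g = 1.
Proof.
move=> f0; exists (fun n => (inv_coefs f n.+1)`_n); apply/funext => n.
rewrite fpsM big_ord_recl subn0.
have -> : \sum_(i < n) f (lift ord0 i) *
      (inv_coefs f (n - lift ord0 i).+1)`_(n - lift ord0 i) =
    \sum_(i < n) f i.+1 * (inv_coefs f n)`_(n - i.+1).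
  apply: eq_bigr => i _; rewrite lift0; congr (_ * _).
  by apply/esym/nth_inv_coefs; have := ltn_ord i; lia.
by rewrite /= nth_rcons size_inv_coefs ltnn eqxx mulrA mulfV // mul1r subrK fps1E.
Qed.

Lemma adic_algebra_fps : adic_algebra X.
Proof.
split.
- move=> f Xf0; apply/funext => n; have := fps_coefXM f n.+1.
  by rewrite Xf0 => <-.
- by move=> a [h /(congr1 (fun f : fps K => f 0%N))]; rewrite fps_coef0C fps_coefXM.
- by move=> h; apply: fps_inv; rewrite fpsB fps1E fps_coefXM subr0 oner_neq0.
- move=> B w u Bs Bw wu; exists (u 0%N)%:A; first exact: subalgebra_const.
  apply/divides_XP; rewrite fpsB fps_coef0M fps_coef0C -fps_coef0M wu.
  by rewrite subrr.
Qed.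

Lemma ordP f m : ord f = Some m <-> f m != 0 /\ forall n, (n < m)%N -> f n = 0.
Proof.
rewrite /ord; case: pselect => [ex|nex]; last first.
  by split=> // -[fm _]; case: nex; exists m.
case: ex_minnP => p fp pmin; split=> [[<-]|[fm m0]].
  split=> // n np; apply/eqP; apply: contraTT np => /pmin.
  by rewrite leqNgt.
congr Some; apply/eqP; rewrite eqn_leq pmin //= leqNgt.
by apply/negP => /m0/eqP; apply/negP.
Qed.

Lemma le_ext_ord m f : le_ext m (ord f) <-> divides (X ^+ m) f.
Proof.
rewrite divides_XnP; case E: (ord f) => [p|] /=.
  have [fp p0] := (ordP f p).1 E; split=> [mp n nm|f0].
    by apply: p0; exact: leq_trans mp.
  by rewrite leqNgt; apply/negP => /f0/eqP; apply/negP.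
split=> // _ n _; move: E; rewrite /ord; case: pselect => // nex _.
by apply/eqP; apply: contrapT => /negP fn; apply: nex; exists n.
Qed.

Lemma ord_factor f m :
  ord f = Some m <-> exists2 w : fps K, w 0%N != 0 & f = X ^+ m * w.
Proof.
split=> [/ordP[fm /divides_XnP[w fE]]|[w w0 ->]].
  by exists w => //; move: fm; rewrite fE fps_coefXnM ltnn subnn.
apply/ordP; rewrite fps_coefXnM ltnn subnn; split=> // n nm.
by rewrite fps_coefXnM nm.
Qed.

Lemma ordM f g m p : ord f = Some m -> ord g = Some p -> ord (f * g) = Some (m + p)%N.
Proof.
move=> /ord_factor[w w0 ->] /ord_factor[v v0 ->]; apply/ord_factor.
(* Without the type annotation [w * v] would be the pointwise product. *)
exists (w * v : fps K); first by rewrite fps_coef0M mulf_neq0.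
by rewrite exprD mulrACA.
Qed.

Lemma fps_ord_inj f m p : ord f = Some m -> ord f = Some p -> m = p.
Proof. by move=> -> []. Qed.

Lemma ord_finite_value f m : ord f = Some m -> finite_value X f.
Proof.
move=> /ord_factor[w /fps_inv[v wv] ->].
by exists m, v; rewrite -mulrA wv mulr1.
Qed.

Lemma finite_value_ord f : finite_value X f -> exists m, ord f = Some m.
Proof.
move=> [N [g XN]]; case E: (ord f) => [m|]; first by exists m.
have /le_ext_ord/divides_XnP/(_ N (ltnSn N)) f0 : le_ext N.+1 (ord f) by rewrite E.
have fz : f = 0.
  apply/funext => n.
  have /le_ext_ord/divides_XnP/(_ n (ltnSn n)) // : le_ext n.+1 (ord f) by rewrite E.
have := fps_coefXnM N 1 N; rewrite mulr1 XN fz mul0r ltnn subnn fps1E => /esym/eqP.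
by rewrite oner_eq0.
Qed.

Lemma divides_ord x f m : ord x = Some m -> divides x f <-> divides (X ^+ m) f.
Proof.
move=> /ord_factor[w /fps_inv[v wv] ->]; split=> -[h ->].
  by exists (w * h); rewrite mulrA.
by exists (v * h); rewrite -mulrA [w * _]mulrA wv mul1r.
Qed.

Lemma divides_X_ord x m : ord x = Some m -> divides X x <-> (0 < m)%N.
Proof.
move=> /ordP[xm x0]; rewrite divides_XP; case: m xm x0 => [|m] xm x0.
  by split=> // /eqP; rewrite (negbTE xm).
by split=> // _; exact: x0.
Qed.

Definition agree_below N f g := forall n, (n < N)%N -> f n = g n.

Lemma agree_belowP N f g : agree_below N f g <-> divides (X ^+ N) (f - g).
Proof.
rewrite divides_XnP; split=> H n /H; first by move=> fg; rewrite fpsB fg subrr.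
by rewrite fpsB => /eqP; rewrite subr_eq0 => /eqP.
Qed.

Lemma agree_below_ord N m f g :
  (m < N)%N -> agree_below N f g -> ord f = Some m -> ord g = Some m.
Proof.
move=> mN fg /ordP[fm f0]; apply/ordP; rewrite -fg //; split=> // n nm.
by rewrite -fg ?f0 //; exact: ltn_trans mN.
Qed.

(** From [x (z - z') = (y - y') - (x - x') z'] the right side is divisible by [X ^+ N], and [x] is
    [X ^+ e] times a unit. *)
Lemma agree_below_div N e x x' y y' z z' :
  ord x = Some e -> x * z = y -> x' * z' = y' ->
  agree_below N x x' -> agree_below N y y' -> agree_below (N - e) z z'.
Proof.
move=> /ord_factor[w w0 xE] xz xz' /agree_belowP[h hE] /agree_belowP[k kE].
have [v wv] := fps_inv w0.
have [Ne|eN] := leqP N e; first by rewrite (eqP (_ : N - e == 0)%N).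
apply/agree_belowP; exists (v * (k - h * z')).
have Xe : finite_value X (X ^+ e).
  by exists e, 1; rewrite mulr1.
apply: (finite_value_inj adic_algebra_fps Xe).
have -> : X ^+ e * (z - z') = v * (x * (z - z')).
  by rewrite xE -mulrA mulrCA [v * _]mulrA [v * w]mulrC wv mul1r.
have -> : x * (z - z') = (y - y') - (x - x') * z'.
  by rewrite -xz -xz'; ring.
rewrite hE kE [X ^+ e * _]mulrA -exprD subnKC; last exact: ltnW.
by ring.
Qed.

End PowerSeries.

Section PowerSeriesPairs.
Variable K : fieldType.
Implicit Types f g x : fps2 K.
Local Notation X := (fpsX K).
Local Notation XX := ((fpsX K, fpsX K) : fps2 K).

Lemma divides_pair x f : divides x f <-> divides x.1 f.1 /\ divides x.2 f.2.
Proof.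
split=> [[h ->]|]; first by split; [exists h.1 | exists h.2].
case: f => f1 f2 /= [[h ->] [k ->]]; exists (h, k); by [].
Qed.

Lemma expr_pair x n : x ^+ n = (x.1 ^+ n, x.2 ^+ n).
Proof. by elim: n => [|n IHn]; rewrite ?expr0 // !exprS IHn. Qed.

Lemma divides_XXP f : divides XX f <-> f.1 0%N = 0 /\ f.2 0%N = 0.
Proof. by rewrite divides_pair !divides_XP. Qed.

(** The two constant terms of [w] may differ, and then no scalar inverts [w] modulo [XX]; a
    polynomial of degree one in [w] does. *)
Lemma adic_algebra_fps2 : adic_algebra XX.
Proof.
have P := adic_algebra_fps K.
split.
- by case=> f1 f2 [/(adic_regular P)-> /(adic_regular P)->].
- by move=> a /divides_pair[/= /(adic_const P)].
- move=> [h1 h2]; have [u uE] := adic_inv1 P h1; have [v vE] := adic_inv1 P h2.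
  by exists (u, v); rewrite -[LHS]/((1 - X * h1) * u, (1 - X * h2) * v) uE vE.
- move=> B w u Bs Bw wu; have [B1 BD BM] := Bs.
  pose a := u.1 0%N; pose b := u.2 0%N.
  (* [v] solves [1 - w v = (1 - a w) (1 - b w)]. *)
  exists (- (a * b) *: w + (a + b)%:A).
    by apply: BD => //; exact: subalgebra_const.
  have wa : w.1 0%N * a = 1.
    by rewrite -fps_coef0M -[w.1 * _]/((w * u).1) wu /= fps1E.
  have wb : w.2 0%N * b = 1.
    by rewrite -fps_coef0M -[w.2 * _]/((w * u).2) wu /= fps1E.
  apply/divides_XXP; split.
    rewrite -[(1 - _).1]/(1 - w.1 * (- (a * b) *: w.1 + (a + b)%:A)).
    rewrite fpsB fps1E fps_coef0M fpsD fpsZ fps_coef0C /=.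
    have -> : 1 - w.1 0%N * (- (a * b) * w.1 0%N + (a + b)) =
      1 + (w.1 0%N * a - 1) * (w.1 0%N * b) - w.1 0%N * a by ring.
    by rewrite wa subrr mul0r addr0 subrr.
  rewrite -[(1 - _).2]/(1 - w.2 * (- (a * b) *: w.2 + (a + b)%:A)).
  rewrite fpsB fps1E fps_coef0M fpsD fpsZ fps_coef0C /=.
  have -> : 1 - w.2 0%N * (- (a * b) * w.2 0%N + (a + b)) =
    1 + (w.2 0%N * b - 1) * (w.2 0%N * a) - w.2 0%N * b by ring.
  by rewrite wb subrr mul0r addr0 subrr.
Qed.

Lemma nu_isP f a : nu_is f a <-> ord f.1 = Some a.1 /\ ord f.2 = Some a.2.
Proof. by rewrite /nu_is /nu; split=> [[-> ->]|[-> ->]]. Qed.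

Lemma nu_is_inj f a b : nu_is f a -> nu_is f b -> a = b.
Proof. by case: a b => a1 a2 [b1 b2]; rewrite /nu_is => -> [-> ->]. Qed.

Lemma nu_geP f a : nu_ge f a <-> divides (X ^+ a.1, X ^+ a.2) f.
Proof. by rewrite divides_pair /nu_ge !le_ext_ord. Qed.

Lemma nu_isM f g a b : nu_is f a -> nu_is g b -> nu_is (f * g) (a + b).
Proof.
by move=> /nu_isP[f1 f2] /nu_isP[g1 g2]; apply/nu_isP; split; exact: ordM.
Qed.

Lemma divides_nu x f a : nu_is x a -> divides x f <-> nu_ge f a.
Proof.
move=> /nu_isP[x1 x2]; rewrite nu_geP !divides_pair /=.
by rewrite (divides_ord _ x1) (divides_ord _ x2).
Qed.

Lemma nu_is_finite_value x a : nu_is x a -> finite_value XX x.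
Proof.
move=> xa; exists (maxn a.1 a.2); rewrite (divides_nu _ xa) nu_geP expr_pair.
apply/divides_pair; split=> /=.
  by exists (X ^+ (maxn a.1 a.2 - a.1)); rewrite -exprD subnKC ?leq_maxl.
by exists (X ^+ (maxn a.1 a.2 - a.2)); rewrite -exprD subnKC ?leq_maxr.
Qed.

Lemma finite_value_nu_is x : finite_value XX x -> exists a, nu_is x a.
Proof.
move=> [N]; rewrite expr_pair => /divides_pair /= [d1 d2].
have [|m1 E1] := @finite_value_ord K x.1; first by exists N.
have [|m2 E2] := @finite_value_ord K x.2; first by exists N.
by exists (m1, m2); exact/nu_isP.
Qed.

Lemma divides_XX_nu x a : nu_is x a -> divides XX x <-> (0 < a.1)%N /\ (0 < a.2)%N.
Proof.
move=> /nu_isP[x1 x2]; rewrite divides_pair /=.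
by rewrite (divides_X_ord x1) (divides_X_ord x2).
Qed.

Lemma arf_subring_is_arf (A : set (fps2 K)) : arf_subring XX A -> is_arf A.
Proof.
move=> [As Aq]; split; first exact/subring_closedP.
move=> x a Ax xa; apply/subring_closedP.
have -> : [set s | exists2 r, ge_part A a r & x * s = r] = [set s | A (x * s)].
  apply/seteqP; split=> s /=; first by move=> [r [Ar _] ->].
  move=> Axs; exists (x * s) => //; split=> //.
  by apply/(divides_nu _ xa); exists s.
by apply: Aq => //; exact: nu_is_finite_value xa.
Qed.

End PowerSeriesPairs.

(** * One branch *)

Section CenteredGenerators.
Variables (K : fieldType) (A : comAlgType K) (pi : A).

(** The generators of a blow-up made positive, so that it can be blown up again. The constants are
    left free because for pairs one scalar must serve both components. *)
Definition centered k (x : A) (z : 'I_k -> A) (a : 'I_k -> K) (i : 'I_k.+1) :=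
  if unlift ord0 i is Some j then z j - (a j)%:A else x.

Lemma centered0 k x (z : 'I_k -> A) a : centered x z a ord0 = x.
Proof. by rewrite /centered unlift_none. Qed.

Lemma centeredS k x (z : 'I_k -> A) a j :
  centered x z a (lift ord0 j) = z j - (a j)%:A.
Proof. by rewrite /centered liftK. Qed.

Lemma psalg_centered k x (z : 'I_k -> A) a :
  psalg pi (range (centered x z a)) = psalg pi ([set x] `|` range z).
Proof.
apply: eq_psalg => [_ [i _ <-]|f].
  have Rs := psalg_subalgebra pi ([set x] `|` range z).
  have [_ RB _] := subalgebra_subring Rs.
  case: (unliftP ord0 i) => [j ->|->]; rewrite ?centered0 ?centeredS.
    apply: RB; last exact: subalgebra_const.
    by apply: sub_psalg; right; exists j.
  by apply: sub_psalg; left.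
have Rs := psalg_subalgebra pi (range (centered x z a)).
case=> [->|[j _ <-]].
  by apply: sub_psalg; exists ord0; rewrite ?centered0.
rewrite -(subrK (a j)%:A (z j)).
apply: (subringD (subalgebra_subring Rs)).
  by apply: sub_psalg; exists (lift ord0 j) => //; rewrite centeredS.
exact: subalgebra_const.
Qed.

Lemma quotients_exist k (x : A) (y : 'I_k -> A) :
  (forall j, divides x (y j)) -> exists z, quotients x y z.
Proof.
move=> xy; have /choice[z zE] : forall j, exists h, x * h = y j.
  by move=> j; have [h ->] := xy j; exists h.
by exists z.
Qed.

End CenteredGenerators.

Section OneBranch.
Variable K : fieldType.
Implicit Types (R : set (fps K)) (f x : fps K).
Local Notation X := (fpsX K).

Let P := adic_algebra_fps K.

Lemma mult1_pointed R m : pointed X R -> is_mult1 R m ->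
  (exists2 r, positive_part X R r & ord r = Some m) /\
  (forall r, positive_part X R r -> divides (X ^+ m) r).
Proof.
move=> Rp [M [/(pointed_maximal P _ Rp) -> Mr Mm]]; split=> // r /Mm.
by move/le_ext_ord.
Qed.

Lemma is_mult1_inj R m p : is_local R -> is_mult1 R m -> is_mult1 R p -> m = p.
Proof.
move=> [M0 [_ Muniq]] [M [/Muniq<- [r Mr rE] Mm]] [N [/Muniq<- [s Ms sE] Mp]].
by apply/eqP; rewrite eqn_leq; have := Mm _ Ms; have := Mp _ Mr;
  rewrite rE sE /= => -> ->.
Qed.

Lemma mult1_psalg k (y z : 'I_k -> fps K) x m :
  (forall j, divides X (y j)) -> psalg1 (range y) x ->
  ord x = Some m -> (0 < m)%N -> quotients x y z ->
  is_mult1 (psalg1 (range y)) m.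
Proof.
move=> ypos Rx xm m0 xz; have Rp := psalg_pointed P ypos.
have pix : divides X x by apply/(divides_X_ord xm).
exists (positive_part X (psalg1 (range y))); split.
- exact/(pointed_maximal P _ Rp).
- by exists x => //; split.
- move=> r Rr; apply/le_ext_ord; rewrite -(divides_ord _ xm).
  have [w _ ->] := positive_part_sub P (ord_finite_value xm) pix xz Rr.
  by exists w.
Qed.

Lemma is_blowup1_inj R R' R'' : is_blowup1 R R' -> is_blowup1 R R'' -> R' = R''.
Proof.
move=> [k [y [z [x [m [RE ypos [Rm Rx xm] xz ->]]]]]].
move=> [k' [y' [z' [x' [m' [RE' ypos' [Rm' Rx' x'm] xz' ->]]]]]].
have {}ypos j : divides X (y j) by rewrite -[X]expr1; exact/le_ext_ord.
have {}ypos' j : divides X (y' j) by rewrite -[X]expr1; exact/le_ext_ord.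
have Rp : pointed X R by rewrite RE; exact: psalg_pointed.
have posx p u : is_mult1 R p -> ord u = Some p -> divides X u.
  move=> /(mult1_pointed Rp)[[r [_ pr] rp] _] up.
  by apply/(divides_X_ord up)/(divides_X_ord rp).
apply: (eq_psalg_quotients P _ ypos ypos') xz xz'.
- by rewrite -[LHS]RE.
- by rewrite -[psalg _ _]RE.
- by rewrite -[psalg _ _]RE'.
- exact: ord_finite_value xm.
- exact: posx xm.
- exact: ord_finite_value x'm.
- exact: posx x'm.
Qed.

Definition arf_bound1 R c := forall B, arf_subring X B -> R `<=` B ->
  forall d, exists2 f, B f & ord f = Some (c + d)%N.

(** A nonzero value of [K + x B] comes from [x B], so subtracting [e] gives a value of [B]. The
    value 0 comes from the constants and says nothing about [B], whence the separate case. *)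
Lemma arf_bound1_blowup k (y z : 'I_k -> fps K) x e c :
  ord x = Some e -> (0 < e)%N -> quotients x y z ->
  arf_bound1 (psalg1 (range y)) c ->
  (c = 0%N /\ e = 1%N) \/
  ((e <= c)%N /\ arf_bound1 (psalg1 ([set x] `|` range z)) (c - e)).
Proof.
move=> xe e0 xz Rc; have xfin := ord_finite_value xe.
have pix : divides X x by apply/(divides_X_ord xe).
have key B d : arf_subring X B -> psalg1 ([set x] `|` range z) `<=` B ->
    (c + d != 0)%N -> exists2 b, B b & exists2 p, ord b = Some p & (c + d = e + p)%N.
  move=> Barf R'B cd.
  have R's := psalg_subalgebra X ([set x] `|` range z).
  have Carf : arf_subring X (const_plus x B).
    apply: arf_const_plus => //.
      by move=> a; apply: R'B; exact: subalgebra_const.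
    by apply/R'B/sub_psalg; left.
  have RC : psalg1 (range y) `<=` const_plus x B.
    move=> r /(const_plus_psalg P xfin pix xz)[a [b R'b rE]].
    by exists a, b => //; exact: R'B.
  have [f [a [b Bb fE]] fcd] := Rc _ Carf RC d.
  have a0 : a = 0.
    have [f0 /(_ 0%N)] := (ordP _ _).1 fcd; rewrite lt0n => /(_ cd).
    move/divides_XP: pix => x0.
    by rewrite fE fpsD fps_coef0M x0 mul0r addr0 fps_coef0C.
  have fxb : f = x * b by rewrite fE a0 scale0r add0r.
  exists b => //; have [p bp] : exists p, ord b = Some p.
    apply: finite_value_ord; apply: (@finite_value_factor _ _ _ x).
    by rewrite -fxb; exact: ord_finite_value fcd.
  exists p => //; apply: fps_ord_inj fcd _.
  by rewrite fxb; exact: ordM.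
(* With [c = 0] the value 1 is still attained in [K + x K[[t]]], and its nonzero values are at least
   [e]; so [e = 1]. *)
have [c0|c0] := eqVneq c 0%N.
  left; split=> //; have [||b _ [p _]] := key setT 1%N (arf_subringT X); rewrite ?c0 //.
  by lia.
right; have ec : (e <= c)%N.
  have [||b _ [p _]] := key setT 0%N (arf_subringT X); rewrite ?addn0 //.
  by move=> ->; exact: leq_addr.
split=> // B Barf R'B d; have [|b Bb [p bp cd]] := key B d Barf R'B; first by lia.
by exists b => //; rewrite bp; congr Some; lia.
Qed.

Lemma exists_min_ord k (y y' : 'I_k -> fps K) N :
  (forall j, agree_below N (y j) (y' j)) ->
  (exists j, ~ divides (X ^+ N) (y j)) ->
  exists j e, [/\ (e < N)%N, ord (y j) = Some e, ord (y' j) = Some e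
    & forall i, divides (X ^+ e) (y i) /\ divides (X ^+ e) (y' i)].
Proof.
move=> yy' [j0 yj0].
have ex : exists n, [exists j, y j n != 0].
  apply: contrapT => nex; apply: yj0; apply/divides_XnP => n _.
  by apply/eqP; apply: contrapT => /negP yn; apply: nex; exists n; apply/existsP; exists j0.
case: (ex_minnP ex) => e /existsP[j yje] emin.
have y0 i n : (n < e)%N -> y i n = 0.
  move=> ne; apply/eqP; apply: contraTT ne => yn; rewrite -leqNgt; apply: emin.
  by apply/existsP; exists i.
have eN : (e < N)%N.
  rewrite ltnNge; apply/negP => Ne; apply: yj0; apply/divides_XnP => n nN.
  by apply: y0; exact: leq_trans Ne.
have oj : ord (y j) = Some e by apply/ordP; split => // n; exact: y0.
exists j, e; split=> //; first exact: agree_below_ord (yy' j) oj.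
move=> i; split; apply/divides_XnP => n ne; first exact: y0.
by rewrite -yy' ?y0 //; exact: ltn_trans eN.
Qed.

(* Once the bound reaches 0 the generators need not agree to any useful order
   any more, but then both rings contain an element of order 1, and so do all
   their blow-ups. *)
Definition parallel1 R R' := exists k (y y' : 'I_k -> fps K),
  [/\ R = psalg1 (range y), R' = psalg1 (range y'),
      forall j, divides X (y j), forall j, divides X (y' j)
    & (exists2 c, arf_bound1 R c & forall j, agree_below c.+2 (y j) (y' j)) \/
      exists j, ord (y j) = Some 1%N /\ ord (y' j) = Some 1%N].

Lemma parallel1_pointed R R' : parallel1 R R' -> pointed X R /\ pointed X R'.
Proof.
by move=> [k [y [y' [-> -> ypos y'pos _]]]]; split; exact: (psalg_pointed P).
Qed.

(** The constants subtracted on the two sides are equal because the quotients agree at least in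
    degrees 0 and 1. In the other alternative [x] and [x'] themselves are the generators of order
    1. *)
Lemma parallel1_psalg k x x' (z z' : 'I_k -> fps K) :
  divides X x -> divides X x' ->
  (exists2 c, arf_bound1 (psalg1 ([set x] `|` range z)) c &
     agree_below c.+2 x x' /\ forall j, agree_below c.+2 (z j) (z' j)) \/
  (ord x = Some 1%N /\ ord x' = Some 1%N) ->
  parallel1 (psalg1 ([set x] `|` range z)) (psalg1 ([set x'] `|` range z')).
Proof.
move=> pix pix' xz.
have centered_pos (u : 'I_k -> fps K) v : divides X v ->
    forall i, divides X (centered v u (fun j => u j 0%N) i).
  move=> pv i; case: (unliftP ord0 i) => [j|] ->; rewrite ?centered0 ?centeredS //.
  by apply/divides_XP; rewrite fpsB fps_coef0C subrr.
exists k.+1, (centered x z (fun j => z j 0%N)), (centered x' z' (fun j => z' j 0%N)).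
rewrite /psalg1 !psalg_centered; split=> //; try exact: centered_pos.
case: xz => [[c Rc [xx' zz']]|[x1 x1']]; last first.
  by right; exists ord0; rewrite !centered0.
left; exists c => // i; case: (unliftP ord0 i) => [j|] ->;
  rewrite ?centered0 ?centeredS // => n nc.
by rewrite !fpsB !fpsZ zz' // (zz' j 0%N).
Qed.

Lemma parallel1_min_ord k (y y' : 'I_k -> fps K) :
  (forall j, divides X (y j)) -> (forall j, divides X (y' j)) ->
  (exists2 c, arf_bound1 (psalg1 (range y)) c &
     forall j, agree_below c.+2 (y j) (y' j)) \/
  (exists j, ord (y j) = Some 1%N /\ ord (y' j) = Some 1%N) ->
  exists j e, [/\ (0 < e)%N, ord (y j) = Some e, ord (y' j) = Some e
    & forall i, divides (X ^+ e) (y i) /\ divides (X ^+ e) (y' i)].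
Proof.
move=> ypos y'pos [[c Rc yy']|[j [yj y'j]]]; last first.
  by exists j, 1%N; split=> // i; rewrite expr1.
have [|j [e [ec yj y'j ye]]] := exists_min_ord yy'.
  apply: contrapT => nex.
  (* If no generator had order below [c + 2], all would be divisible by [X ^+ c.+2]. The descent of
     the bound applies to this divisor too, in the ring or not, and would give [c + 2 <= c] or
     [c + 2 = 1]. *)
  have [z xz] : exists z, quotients (X ^+ c.+2) y z.
    apply: quotients_exist => j; apply: contrapT => yj.
    by apply: nex; exists j.
  have oX : ord (X ^+ c.+2) = Some c.+2.
    by apply/ord_factor; exists 1; rewrite ?mulr1 // fps1E oner_neq0.
  by case: (arf_bound1_blowup oX (ltn0Sn _) xz Rc) => [[_ //]|[]]; lia.
exists j, e; split=> //.
by apply/(divides_X_ord yj).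
Qed.

Lemma parallel1_blowup R R' : parallel1 R R' ->
  exists m S S', [/\ is_mult1 R m, is_mult1 R' m,
    is_blowup1 R S, is_blowup1 R' S' & parallel1 S S'].
Proof.
move=> [k [y [y' [RE R'E ypos y'pos Ryy']]]]; rewrite RE in Ryy' *; rewrite R'E.
have [j [e [e0 yj y'j ye]]] := parallel1_min_ord ypos y'pos Ryy'.
have [z xz] : exists z, quotients (y j) y z.
  by apply: quotients_exist => i; rewrite (divides_ord _ yj); case: (ye i).
have [z' xz'] : exists z', quotients (y' j) y' z'.
  by apply: quotients_exist => i; rewrite (divides_ord _ y'j); case: (ye i).
have Ry : psalg1 (range y) (y j) by apply: sub_psalg; exists j.
have R'y : psalg1 (range y') (y' j) by apply: sub_psalg; exists j.
have Rm := mult1_psalg ypos Ry yj e0 xz.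
have R'm := mult1_psalg y'pos R'y y'j e0 xz'.
exists e, (psalg1 ([set y j] `|` range z)), (psalg1 ([set y' j] `|` range z')).
split=> //.
- exists k, y, z, (y j), e; split=> // i.
  by apply/le_ext_ord; rewrite expr1.
- exists k, y', z', (y' j), e; split=> // i.
  by apply/le_ext_ord; rewrite expr1.
apply: parallel1_psalg; [by apply/(divides_X_ord yj) | by apply/(divides_X_ord y'j)|].
(* For [e = 1] the divisors have order 1 and are generators of the two blow-ups. For [e > 1] no
   generator has order 1, so the agreement alternative must hold. *)
have [e1|e1] := eqVneq e 1%N; first by right; rewrite -e1.
left; case: Ryy' => [[c Rc yy']|[i [yi _]]]; last first.
  have := (ye i).1; rewrite divides_XnP => /(_ 1%N); have [+ _] := (ordP _ _).1 yi.
  by move=> /eqP y1 /(_ _)/y1 []; lia.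
case: (arf_bound1_blowup yj e0 xz Rc) => [[_ e1']|[ec R'c]].
  by rewrite e1' in e1.
have ce2 : (c.+2 - e = (c - e).+2)%N by lia.
exists (c - e)%N => //; split=> [n nc|l]; first by apply: yy'; lia.
by rewrite -ce2; apply: agree_below_div yj (xz l) (xz' l) _ _; exact: yy'.
Qed.

End OneBranch.

(** * Products of branches *)

Section Products.
Variable K : fieldType.
Implicit Types (R : set (fps2 K)) (f x : fps2 K).
Local Notation X := (fpsX K).
Local Notation XX := ((fpsX K, fpsX K) : fps2 K).

Let P := adic_algebra_fps K.

(* [v] has constant terms [(1, 0)], so [1 - (1 - v^N)^N] tends to [(1, 0)]. *)
Lemma idempotent_in R w : subalgebra R -> adic_closed XX R -> R w ->
  w.1 0%N != w.2 0%N -> R (1, 0).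
Proof.
move=> Rs Rc Rw wab; have [R1 RD RM] := Rs.
pose a := w.1 0%N; pose b := w.2 0%N.
have ab : a - b != 0 by rewrite subr_eq0.
(* This is [(w - b) / (a - b)], the affine change that moves the constant terms [(a, b)] to
   [(1, 0)]. *)
pose v := (a - b)^-1 *: w + (- ((a - b)^-1 * b))%:A.
have Rv : R v by apply: RD => //; exact: subalgebra_const.
have v1 : divides X (1 - v.1).
  apply/divides_XP.
  rewrite -[v.1]/((a - b)^-1 *: w.1 + (- ((a - b)^-1 * b))%:A).
  rewrite fpsB fps1E fpsD fpsZ fps_coef0C -/a.
  by rewrite -mulrBr mulVf // subrr.
have v2 : divides X v.2.
  apply/divides_XP.
  rewrite -[v.2]/((a - b)^-1 *: w.2 + (- ((a - b)^-1 * b))%:A).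
  by rewrite fpsD fpsZ fps_coef0C -/b subrr.
have Rsub := subalgebra_subring Rs; have [_ RB _] := Rsub.
apply: Rc => N; exists (1 - (1 - v ^+ N) ^+ N).
  apply: (RB _ _ R1); apply: (subringX _ Rsub).
  by apply: (RB _ _ R1); exact: (subringX _ Rsub).
have expX (x f : fps K) n : divides x f -> divides (x ^+ n) (f ^+ n).
  by move=> [h ->]; exists (h ^+ n); rewrite exprMn.
pose d : fps2 K := (1, 0) - (1 - (1 - v ^+ N) ^+ N).
have d1 : d.1 = (1 - v.1 ^+ N) ^+ N.
  rewrite -[LHS]/(1 - (1 - ((1 - v ^+ N) ^+ N).1)) expr_pair opprB addrC subrK.
  by rewrite -[(1 - _).1]/(1 - (v ^+ N).1) expr_pair.
have d2 : d.2 = (1 - v.2 ^+ N) ^+ N - 1.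
  rewrite -[LHS]/(0 - (1 - ((1 - v ^+ N) ^+ N).2)) expr_pair sub0r opprB.
  by rewrite -[(1 - _).2]/(1 - (v ^+ N).2) expr_pair.
(* In the first branch [1 - v^N] is a multiple of [1 - v], hence of [X], and its [N]th power
   supplies [X ^+ N]. In the second, [(1 - v^N)^N - 1] is a multiple of [v^N]. *)
apply/divides_pair; rewrite -/d d1 d2 expr_pair; split.
  apply: expX; case: N {d d1 d2} => [|N].
    by rewrite expr0 subrr; exact: divides0.
  rewrite -opprB subrX1 -mulNr opprB; exact: dividesMr.
rewrite subrX1; apply: dividesMr.
have -> : 1 - v.2 ^+ N - 1 = v.2 ^+ N * -1 by rewrite mulrN1; ring.
exact/dividesMr/expX.
Qed.

Lemma psalg2_fst (G : set (fps2 K)) f : psalg2 G f -> psalg1 (fst @` G) f.1.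
Proof.
have [S1 SD SM] := psalg_subalgebra X (fst @` G).
suff : psalg2 G `<=` [set f | psalg1 (fst @` G) f.1] by exact.
apply: psalg_min.
- split=> //= [a f1 f2 | f1 f2]; [exact: SD | exact: SM].
- move=> f1 f1G; apply: (@psalg_closed _ _ X) => N.
  have [g gG /divides_pair[+ _]] := f1G N.
  by rewrite expr_pair => ?; exists g.1.
- by move=> g Gg; apply: sub_psalg; exists g.
Qed.

Lemma psalg2_snd (G : set (fps2 K)) f : psalg2 G f -> psalg1 (snd @` G) f.2.
Proof.
have [S1 SD SM] := psalg_subalgebra X (snd @` G).
suff : psalg2 G `<=` [set f | psalg1 (snd @` G) f.2] by exact.
apply: psalg_min.
- split=> //= [a f1 f2 | f1 f2]; [exact: SD | exact: SM].
- move=> f1 f1G; apply: (@psalg_closed _ _ X) => N.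
  have [g gG /divides_pair[_ +]] := f1G N.
  by rewrite expr_pair => ?; exists g.2.
- by move=> g Gg; apply: sub_psalg; exists g.
Qed.

(** The series [f] with [(f, 0)] in the ring form a closed subalgebra, with unit thanks to [(1, 0)],
    which contains the first components of the generators; likewise for the second branch. *)
Lemma psalg2_product (G : set (fps2 K)) : psalg2 G (1, 0) ->
  psalg2 G = psalg1 (fst @` G) `*` psalg1 (snd @` G).
Proof.
move=> e1; have Rs := psalg_subalgebra XX G; have Rsub := subalgebra_subring Rs.
have [R1 RD RM] := Rs; have R0 := subring0 Rsub.
have e2 : psalg2 G (0, 1).
  have -> : (0, 1) = 1 - (1, 0) :> fps2 K.
    by rewrite -[RHS]/(1 - 1, 1 - 0) subrr subr0.
  by have [_ RB _] := Rsub; exact: RB.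
apply/seteqP; split=> [f Rf|[f1 f2] [/= Rf1 Rf2]].
  by split; [exact: psalg2_fst | exact: psalg2_snd].
have -> : (f1, f2) = (f1, 0) + (0, f2) :> fps2 K.
  by rewrite -[RHS]/(f1 + 0, 0 + f2) addr0 add0r.
apply: (subringD Rsub).
- have : psalg1 (fst @` G) `<=` [set f | psalg2 G (f, 0)]; last exact.
  apply: psalg_min.
  + split=> //= [a f g Rf Rg|f g Rf Rg].
      by have := RD a _ _ Rf Rg; rewrite -[_ + _]/(a *: f + g, a *: 0 + 0) scaler0 addr0.
    by have := RM _ _ Rf Rg; rewrite -[_ * _]/(f * g, 0 * 0) mul0r.
  + move=> f Rf; apply: (@psalg_closed _ _ XX) => N.
    have [g Rg gE] := Rf N; exists (g, 0) => //.
    by apply/divides_pair; rewrite expr_pair; split=> //=;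
      rewrite subrr; exact: divides0.
  + move=> _ [g Gg <-] /=; have := RM _ _ e1 (sub_psalg _ Gg).
    by rewrite -[_ * _]/(1 * g.1, 0 * g.2) mul1r mul0r.
- have : psalg1 (snd @` G) `<=` [set f | psalg2 G (0, f)]; last exact.
  apply: psalg_min.
  + split=> //= [a f g Rf Rg|f g Rf Rg].
      by have := RD a _ _ Rf Rg; rewrite -[_ + _]/(a *: 0 + 0, a *: f + g) scaler0 addr0.
    by have := RM _ _ Rf Rg; rewrite -[_ * _]/(0 * 0, f * g) mul0r.
  + move=> f Rf; apply: (@psalg_closed _ _ XX) => N.
    have [g Rg gE] := Rf N; exists (0, g) => //.
    by apply/divides_pair; rewrite expr_pair; split=> //=;
      rewrite subrr; exact: divides0.
  + move=> _ [g Gg <-] /=; have := RM _ _ e2 (sub_psalg _ Gg).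
    by rewrite -[_ * _]/(0 * g.1, 1 * g.2) mul1r mul0r.
Qed.

Lemma is_local_nonempty (A : comNzRingType) (R : set A) : is_local R -> R 0.
Proof. by move=> [M [[[MR M0 _ _] _ _] _]]; exact: MR. Qed.

(** Each factor is a slice of [R] through 0, and 0 lies in the other factor because a local ring
    here has an ideal. *)
Lemma splits_inj R (R1 R2 S1 S2 : set (fps K)) :
  splits R R1 R2 -> splits R S1 S2 -> R1 = S1 /\ R2 = S2.
Proof.
move=> [-> /is_local_nonempty R10 /is_local_nonempty R20].
move=> [RE /is_local_nonempty S10 /is_local_nonempty S20].
have E f : (R1 f.1 /\ R2 f.2) = (S1 f.1 /\ S2 f.2).
  by rewrite -[LHS]/((R1 `*` R2) f) RE.
split; apply/seteqP; split=> f Hf.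
- by have := E (f, 0); rewrite /= => /propeqP[+ _] => -[].
- by have := E (f, 0); rewrite /= => /propeqP[_ +] => -[].
- by have := E (0, f); rewrite /= => /propeqP[+ _] => -[].
- by have := E (0, f); rewrite /= => /propeqP[_ +] => -[].
Qed.

Lemma maximal_ideal_inv (A : comNzRingType) (R I : set A) :
  is_ideal R I -> I <> R ->
  (forall r, R r -> ~ I r -> exists2 s, R s & I (1 - s * r)) ->
  maximal_ideal R I.
Proof.
move=> Ii INR Iinv; split=> // J [JR J0 JD JM] IJ.
case: (pselect (J `<=` I)) => [JI|nJI]; first by left; apply/seteqP.
right; apply/seteqP; split=> // f Rf.
have [g Jg Ig] : exists2 g, J g & ~ I g.
  apply: contrapT => ng; apply: nJI => g Jg.
  by apply: contrapT => gI; apply: ng; exists g.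
have [s Rs /IJ Js] := Iinv g (JR _ Jg) Ig.
rewrite -[f]mulr1; apply: (JM) => //; rewrite -(subrK (s * g) 1).
by apply: JD => //; exact: JM.
Qed.

(** [Q1 x R2] and [R1 x Q2] are both maximal, and they differ since [(1, 0)] lies only in the
    second. *)
Lemma product_not_local (R1 R2 : set (fps K)) :
  pointed X R1 -> pointed X R2 -> ~ is_local (R1 `*` R2).
Proof.
move=> p1 p2 [M [_ Muniq]].
have [[s1 _ _] [s2 _ _]] := (p1, p2).
have [[r11 _ m1] r10] := (s1, subring0 (subalgebra_subring s1)).
have [[r21 _ m2] r20] := (s2, subring0 (subalgebra_subring s2)).
have [[_ Q10 QD1 QM1] [_ Q20 QD2 QM2]] :=
  (positive_part_ideal p1, positive_part_ideal p2).
pose Q1 := positive_part X R1; pose Q2 := positive_part X R2.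
have max1 : maximal_ideal (R1 `*` R2) (Q1 `*` R2).
  apply: maximal_ideal_inv.
  - split=> [f [[? _] ?]||f g [? ?] [? ?]|f g [? ?] [? ?]]; split=> //=.
    + exact: QD1.
    + exact: (subringD (subalgebra_subring s2)).
    + exact: QM1.
    + exact: m2.
  - move=> E; apply: (positive_part_neq P p1); apply/seteqP.
    split=> [f []//|f Rf]; have [] // : (Q1 `*` R2) (f, 0) by rewrite E.
  - move=> [f g] [/= Rf Rg] Qf.
    have [|v Rv fv] := pointed_unit P p1 Rf; first by move=> ?; apply: Qf.
    exists (v, 0) => //; split; first by rewrite /= mulrC fv subrr.
    by rewrite /= mul0r subr0.
have max2 : maximal_ideal (R1 `*` R2) (R1 `*` Q2).
  apply: maximal_ideal_inv.
  - split=> [f [? [? _]]||f g [? ?] [? ?]|f g [? ?] [? ?]]; split=> //=.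
    + exact: (subringD (subalgebra_subring s1)).
    + exact: QD2.
    + exact: m1.
    + exact: QM2.
  - move=> E; apply: (positive_part_neq P p2); apply/seteqP.
    split=> [f []//|f Rf]; have [] // : (R1 `*` Q2) (0, f) by rewrite E.
  - move=> [f g] [/= Rf Rg] Qg.
    have [|v Rv gv] := pointed_unit P p2 Rg; first by move=> ?; apply: Qg.
    exists (0, v) => //; split; last by rewrite /= mulrC gv subrr.
    by rewrite /= mul0r subr0.
apply: (positive_part_neq P p1); apply/seteqP; split=> [f []//|f Rf].
have [] // : (Q1 `*` R2) (f, 0).
by rewrite -(Muniq _ max1) (Muniq _ max2).
Qed.

End Products.

(** * Two branches *)

Section TwoBranches.
Variable K : fieldType.
Implicit Types (R S : set (fps2 K)) (f x : fps2 K) (a c : nat * nat).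
Local Notation X := (fpsX K).
Local Notation XX := ((fpsX K, fpsX K) : fps2 K).

Let P := adic_algebra_fps K.
Let P2 := adic_algebra_fps2 K.

Lemma is_mult2_inj R a b : is_local R -> is_mult2 R a -> is_mult2 R b -> a = b.
Proof.
have le (a' b' : nat * nat) (M N : set (fps2 K)) : M = N ->
    (exists2 r, M r & ord r.1 = Some a'.1) ->
    (exists2 r, M r & ord r.2 = Some a'.2) ->
    (forall r, N r -> nu_ge r b') -> (b'.1 <= a'.1)%N /\ (b'.2 <= a'.2)%N.
  move=> -> [r Nr rE] [s Ns sE] Nb.
  by have [+ _] := Nb _ Nr; have [_ +] := Nb _ Ns; rewrite /nu /= rE sE.
move=> [M0 [_ Muniq]] [M [/Muniq ME Ma1 Ma2 Ma]] [N [/Muniq NE Nb1 Nb2 Nb]].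
have MN : M = N by rewrite -ME.
have [] := le a b _ _ MN Ma1 Ma2 Nb; have [] := le b a _ _ (esym MN) Nb1 Nb2 Ma.
case: a b {Ma1 Ma2 Ma Nb1 Nb2 Nb} => a1 a2 [b1 b2] /= *.
by congr (_, _); lia.
Qed.

Lemma mult2_psalg k (y z : 'I_k -> fps2 K) x a :
  (forall j, divides XX (y j)) -> psalg2 (range y) x ->
  nu_is x a -> divides XX x -> quotients x y z ->
  is_mult2 (psalg2 (range y)) a.
Proof.
move=> ypos Rx xa pix xz; have Rp := psalg_pointed P2 ypos.
have [xa1 xa2] := (nu_isP _ _).1 xa.
exists (positive_part XX (psalg2 (range y))); split.
- exact/(pointed_maximal P2 _ Rp).
- by exists x => //; split.
- by exists x => //; split.
- move=> r Rr; apply/(divides_nu _ xa).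
  have [w _ ->] := positive_part_sub P2 (nu_is_finite_value xa) pix xz Rr.
  by exists w.
Qed.

Lemma is_blowup2_inj R R' R'' : is_blowup2 R R' -> is_blowup2 R R'' -> R' = R''.
Proof.
move=> [k [y [z [x [a [RE ypos [Ra Rx xa] xz ->]]]]]].
move=> [k' [y' [z' [x' [a' [RE' ypos' [Ra' Rx' x'a] xz' ->]]]]]].
have pos g : nu_ge g (1, 1)%N -> divides XX g by rewrite nu_geP !expr1.
have {}ypos j := pos _ (ypos j); have {}ypos' j := pos _ (ypos' j).
have Rp : pointed XX R by rewrite RE; exact: psalg_pointed.
have posx b u : is_mult2 R b -> nu_is u b -> divides XX u.
  move=> [M [/(pointed_maximal P2 _ Rp) -> [r [_ pr] r1] [s [_ ps] s2] _]].
  move=> /nu_isP[u1 u2]; apply/divides_pair.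
  split; [apply/(divides_X_ord u1) | apply/(divides_X_ord u2)].
    by apply/(divides_X_ord r1); case/divides_pair: pr.
  by apply/(divides_X_ord s2); case/divides_pair: ps.
apply: (eq_psalg_quotients P2 _ ypos ypos') xz xz'.
- by rewrite -[LHS]RE.
- by rewrite -[psalg _ _]RE.
- by rewrite -[psalg _ _]RE'.
- exact: nu_is_finite_value xa.
- exact: posx xa.
- exact: nu_is_finite_value x'a.
- exact: posx x'a.
Qed.

Lemma is_blowup_inj R R' R'' : is_blowup R R' -> is_blowup R R'' -> R' = R''.
Proof.
move=> [[Rl RR']|[Rnl [R1 [R2 [S1 [S2 [RE RS1 RS2 ->]]]]]]].
  by move=> [[_ RR'']|[]//]; exact: is_blowup2_inj RR' RR''.
move=> [[]//|[_ [R3 [R4 [S3 [S4 [RE' RS3 RS4 ->]]]]]]].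
have [E1 E2] := splits_inj RE RE'; rewrite -E1 in RS3; rewrite -E2 in RS4.
by rewrite (is_blowup1_inj RS1 RS3) (is_blowup1_inj RS2 RS4).
Qed.

(** Uniqueness turns the choice made by [xget] into any blow-up computed by hand. *)
Lemma blowup_eq R R' : is_blowup R R' -> blowup R = R'.
Proof.
by move=> RR'; apply: xget_unique => // S RS; exact: is_blowup_inj RS RR'.
Qed.

Definition arf_bound2 R c := forall B, arf_subring XX B -> R `<=` B ->
  forall d : nat * nat, values B (c + d).

Lemma arf_bound2_blowup k (y z : 'I_k -> fps2 K) x e c :
  nu_is x e -> divides XX x -> quotients x y z ->
  arf_bound2 (psalg2 (range y)) c ->
  [/\ (e.1 <= c.1)%N, (e.2 <= c.2)%N
    & arf_bound2 (psalg2 ([set x] `|` range z)) (c.1 - e.1, c.2 - e.2)%N].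
Proof.
move=> xe pix xz Rc; have xfin := nu_is_finite_value xe.
have key B d : arf_subring XX B -> psalg2 ([set x] `|` range z) `<=` B ->
    (0 < c.1 + d.1)%N \/ (0 < c.2 + d.2)%N ->
    exists2 b, B b & exists2 p, nu_is b p &
      (c.1 + d.1 = e.1 + p.1)%N /\ (c.2 + d.2 = e.2 + p.2)%N.
  move=> Barf R'B cd.
  have R's := psalg_subalgebra XX ([set x] `|` range z).
  have Carf : arf_subring XX (const_plus x B).
    apply: arf_const_plus => //.
      by move=> a; apply: R'B; exact: subalgebra_const.
    by apply/R'B/sub_psalg; left.
  have RC : psalg2 (range y) `<=` const_plus x B.
    move=> r /(const_plus_psalg P2 xfin pix xz)[a [b R'b rE]].
    by exists a, b => //; exact: R'B.
  have [f [a [b Bb fE]] fcd] := Rc _ Carf RC d.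
  have [f1 f2] := (nu_isP _ _).1 fcd.
  (* The same scalar [a] appears in both branches, so one positive component of the value is enough
     to kill it. *)
  have a0 : a = 0.
    move/divides_XXP: pix => [x1 x2].
    case: cd => cd; [have [_ /(_ _ cd)] := (ordP _ _).1 f1|
                     have [_ /(_ _ cd)] := (ordP _ _).1 f2]; rewrite fE.
      rewrite -[(_ + _).1]/(a%:A + x.1 * b.1).
      by rewrite fpsD fps_coef0M x1 mul0r addr0 fps_coef0C.
    rewrite -[(_ + _).2]/(a%:A + x.2 * b.2).
    by rewrite fpsD fps_coef0M x2 mul0r addr0 fps_coef0C.
  have fxb : f = x * b by rewrite fE a0 scale0r add0r.
  exists b => //; have [p bp] : exists p, nu_is b p.
    apply: finite_value_nu_is; apply: (@finite_value_factor _ _ _ x).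
    by rewrite -fxb; exact: nu_is_finite_value fcd.
  exists p => //.
  have : nu_is f (e + p) by rewrite fxb; exact: nu_isM.
  by move/(nu_is_inj fcd) => -[].
(* The 1 added in the other component makes the value nonzero without changing the one compared. One
   branch has no such room, hence the exceptional case there and none here. *)
have ec1 : (e.1 <= c.1)%N.
  have [//||b _ [p _ []]] := key setT (0, 1)%N (arf_subringT XX).
    by right; rewrite addn1.
  by rewrite addn0 => -> _; exact: leq_addr.
have ec2 : (e.2 <= c.2)%N.
  have [//||b _ [p _ []]] := key setT (1, 0)%N (arf_subringT XX).
    by left; rewrite addn1.
  by rewrite addn0 => _ ->; exact: leq_addr.
have e1 : (0 < e.1)%N by have [] := (divides_XX_nu xe).1 pix.
split=> // B Barf R'B d; have [|b Bb [p bp [cd1 cd2]]] := key B d Barf R'B.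
  by left; lia.
exists b => //; rewrite (_ : _ + _ = p) //.
case: p cd1 cd2 {bp} => p1 p2 /= cd1 cd2.
by rewrite -[LHS]/(c.1 - e.1 + d.1, c.2 - e.2 + d.2)%N; congr (_, _); lia.
Qed.

(** An Arf ring [B] of one branch is tested through its product with the full power series ring of
    the other, which is again Arf. *)
Lemma arf_bound2_prod (R1 R2 : set (fps K)) c : arf_bound2 (R1 `*` R2) c ->
  arf_bound1 R1 c.1 /\ arf_bound1 R2 c.2.
Proof.
move=> Rc.
have prod_arf (B1 B2 : set (fps K)) :
    arf_subring X B1 -> arf_subring X B2 -> arf_subring XX (B1 `*` B2).
  move=> [[u1 s1 m1] q1] [[u2 s2 m2] q2]; split.
    split=> // f g [? ?] [? ?]; split; by [exact: s1|exact: s2|exact: m1|exact: m2].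
  move=> x [x1 x2] [N]; rewrite expr_pair => /divides_pair[/= d1 d2].
  have [||v1 t1 n1] := q1 x.1; [by []|by exists N|].
  have [||v2 t2 n2] := q2 x.2; [by []|by exists N|].
  split=> [|f g [? ?] [? ?]|f g [? ?] [? ?]]; first by [].
    by split; [exact: t1 | exact: t2].
  by split; [exact: n1 | exact: n2].
split=> B Barf RB d.
  have [||f [Bf _] /nu_isP[fd _]] := Rc (B `*` setT) _ _ (d, 0)%N.
  - by apply: prod_arf => //; exact: arf_subringT.
  - by move=> f [/RB].
  - by exists f.1.
have [||f [_ Bf] /nu_isP[_ fd]] := Rc (setT `*` B) _ _ (0, d)%N.
- by apply: prod_arf => //; exact: arf_subringT.
- by move=> f [_ /RB].
- by exists f.2.
Qed.

Definition parallel2 R R' := exists k (y y' : 'I_k -> fps2 K),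
  [/\ R = psalg2 (range y), R' = psalg2 (range y'),
      forall j, divides XX (y j), forall j, divides XX (y' j)
    & exists2 c, arf_bound2 R c &
        forall j, agree_below c.1.+2 (y j).1 (y' j).1 /\
                  agree_below c.2.+2 (y j).2 (y' j).2].

Definition parallel R R' := parallel2 R R' \/
  exists R1 R2 R1' R2' : set (fps K), [/\ R = R1 `*` R2, R' = R1' `*` R2',
    parallel1 R1 R1' & parallel1 R2 R2'].

(** The pairs [(a1, b1)] and [(a2, b2)] will be the coefficients, at the two minimal orders, of
    generators minimal in the first and in the second branch. A generator minimal in both is taken
    alone; otherwise the sum works. *)
Lemma nonzero_combination (a1 a2 b1 b2 : K) : a1 != 0 -> b2 != 0 ->
  exists l m : K, l * a1 + m * a2 != 0 /\ l * b1 + m * b2 != 0.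
Proof.
move=> a1N0 b2N0.
have [b10|b1N0] := eqVneq b1 0; last first.
  by exists 1, 0; rewrite !mul0r !addr0 !mul1r.
have [a20|a2N0] := eqVneq a2 0; last first.
  by exists 0, 1; rewrite !mul0r !add0r !mul1r.
by exists 1, 1; rewrite b10 a20 !mul1r addr0 add0r.
Qed.

Lemma ord_combination (f g : fps K) e (l m : K) :
  divides (X ^+ e) f -> divides (X ^+ e) g -> l * f e + m * g e != 0 ->
  ord (l *: f + m *: g) = Some e.
Proof.
move=> /divides_XnP f0 /divides_XnP g0 fg; apply/ordP; split=> // n ne.
by rewrite fpsD !fpsZ f0 // g0 // !mulr0 addr0.
Qed.

Lemma exists_min_nu k (y y' : 'I_k -> fps2 K) c :
  (forall j, divides XX (y j)) -> arf_bound2 (psalg2 (range y)) c ->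
  (forall j, agree_below c.1.+2 (y j).1 (y' j).1 /\
             agree_below c.2.+2 (y j).2 (y' j).2) ->
  exists x x' e, [/\ psalg2 (range y) x /\ psalg2 (range y') x',
    nu_is x e /\ nu_is x' e, divides XX x /\ divides XX x',
    agree_below c.1.+2 x.1 x'.1 /\ agree_below c.2.+2 x.2 x'.2
    & forall i, divides x (y i) /\ divides x' (y' i)].
Proof.
move=> ypos Rc yy'.
have [|j1 [e1 [e1c y1 y1' ye1]]] :=
  @exists_min_ord _ _ (fst \o y) (fst \o y') _ (fun j => (yy' j).1).
  apply: contrapT => nex.
  (* A divisor of all generators if none has first order below [c.1 + 2]; the bound would then give
     [c.1 + 2 <= c.1]. The second component [X] only records positivity. *)
  have oX : nu_is ((X ^+ c.1.+2, X) : fps2 K) (c.1.+2, 1)%N.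
    apply/nu_isP; split; apply/ord_factor; exists 1; rewrite ?mulr1 ?expr1 //.
      by rewrite fps1E oner_neq0.
    by rewrite fps1E oner_neq0.
  have [|z xz] := quotients_exist (x := (X ^+ c.1.+2, X) : fps2 K) (y := y).
    move=> j; apply/divides_pair; split; last by case/divides_pair: (ypos j).
    by apply: contrapT => yj; apply: nex; exists j.
  have [|+ _ _] := arf_bound2_blowup oX _ xz Rc; last by rewrite /=; lia.
  exact/(divides_XX_nu oX).
have [|j2 [e2 [e2c y2 y2' ye2]]] :=
  @exists_min_ord _ _ (snd \o y) (snd \o y') _ (fun j => (yy' j).2).
  apply: contrapT => nex.
  have oX : nu_is ((X, X ^+ c.2.+2) : fps2 K) (1, c.2.+2)%N.
    apply/nu_isP; split; apply/ord_factor; exists 1; rewrite ?mulr1 ?expr1 //.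
      by rewrite fps1E oner_neq0.
    by rewrite fps1E oner_neq0.
  have [|z xz] := quotients_exist (x := (X, X ^+ c.2.+2) : fps2 K) (y := y).
    move=> j; apply/divides_pair; split; first by case/divides_pair: (ypos j).
    by apply: contrapT => yj; apply: nex; exists j.
  have [|_ + _] := arf_bound2_blowup oX _ xz Rc; last by rewrite /=; lia.
  exact/(divides_XX_nu oX).
rewrite /= in y1 y1' y2 y2' ye1 ye2.
have [y1N0 _] := (ordP _ _).1 y1; have [y2N0 _] := (ordP _ _).1 y2.
have [l [m [lm1 lm2]]] :=
  nonzero_combination ((y j2).1 e1) ((y j1).2 e2) y1N0 y2N0.
(* The same combination is used on both sides, so the minimal elements inherit the agreement of the
   generators. *)
pose x := l *: y j1 + m *: y j2; pose x' := l *: y' j1 + m *: y' j2.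
have agree (f g f' g' : fps K) N : agree_below N f f' -> agree_below N g g' ->
    agree_below N (l *: f + m *: g) (l *: f' + m *: g').
  by move=> ff' gg' n nN; rewrite !fpsD !fpsZ ff' ?gg'.
have xx'1 : agree_below c.1.+2 x.1 x'.1.
  by apply: agree; case: (yy' j1); case: (yy' j2).
have xx'2 : agree_below c.2.+2 x.2 x'.2.
  by apply: agree; case: (yy' j1); case: (yy' j2).
have x1 : ord x.1 = Some e1.
  by apply: ord_combination => //; [case: (ye1 j1) | case: (ye1 j2)].
have x2 : ord x.2 = Some e2.
  by apply: ord_combination => //; [case: (ye2 j1) | case: (ye2 j2)].
have xe : nu_is x (e1, e2) by exact/nu_isP.
have x'e : nu_is x' (e1, e2).
  apply/nu_isP; split; first exact: agree_below_ord xx'1 x1.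
  exact: agree_below_ord xx'2 x2.
have combination (u : 'I_k -> fps2 K) : psalg2 (range u) (l *: u j1 + m *: u j2).
  have Rs := psalg_subalgebra XX (range u); have [_ RD _] := Rs.
  have R0 := subring0 (subalgebra_subring Rs).
  apply: (RD); first by apply: sub_psalg; exists j1.
  by rewrite -[m *: _]addr0; apply: RD => //; apply: sub_psalg; exists j2.
have epos : (0 < e1)%N /\ (0 < e2)%N.
  split; first by apply/(divides_X_ord y1); case/divides_pair: (ypos j1).
  by apply/(divides_X_ord y2); case/divides_pair: (ypos j2).
exists x, x', (e1, e2); split=> //.
  by split; [apply/(divides_XX_nu xe) | apply/(divides_XX_nu x'e)].
move=> i; have [[? ?] [? ?]] := (ye1 i, ye2 i).
by split; [apply/(divides_nu _ xe) | apply/(divides_nu _ x'e)];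
  apply/nu_geP/divides_pair.
Qed.

Lemma mult_star_local R a : is_local R -> is_mult2 R a -> mult_star R = [set a].
Proof.
move=> Rl Ra; apply/seteqP; split=> [b [[_ Rb]|[]//]|_ ->]; last by left.
exact: is_mult2_inj Rl Rb Ra.
Qed.

Lemma mult_star_splits R (R1 R2 : set (fps K)) m1 m2 : ~ is_local R -> splits R R1 R2 ->
  is_mult1 R1 m1 -> is_mult1 R2 m2 ->
  mult_star R = [set (m1, 0%N); (0%N, m2)].
Proof.
move=> Rnl RE Rm1 Rm2; apply/seteqP; split=> [v [[]//|[_]]|v vE].
  move=> [S1 [S2 [p1 [p2 [RE' Sp1 Sp2 vE]]]]].
  have [E1 E2] := splits_inj RE' RE; have [_ l1 l2] := RE.
  rewrite E1 in Sp1; rewrite E2 in Sp2.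
  by rewrite -(is_mult1_inj l1 Sp1 Rm1) -(is_mult1_inj l2 Sp2 Rm2).
by right; split=> //; exists R1, R2, m1, m2.
Qed.

(** The constant terms of [z j] and [z' j] coincide, so either both rings are local after centering
    or the same generator splits both. *)
Lemma parallel_after_blowup2 k x x' (z z' : 'I_k -> fps2 K) c :
  divides XX x -> divides XX x' ->
  arf_bound2 (psalg2 ([set x] `|` range z)) c ->
  agree_below c.1.+2 x.1 x'.1 -> agree_below c.2.+2 x.2 x'.2 ->
  (forall j, agree_below c.1.+2 (z j).1 (z' j).1) ->
  (forall j, agree_below c.2.+2 (z j).2 (z' j).2) ->
  parallel (psalg2 ([set x] `|` range z)) (psalg2 ([set x'] `|` range z')).
Proof.
move=> pix pix' Rc x1 x2 z1 z2.
have [same|/existsNP[j /eqP dif]] :=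
  pselect (forall j, (z j).1 0%N = (z j).2 0%N).
  left; exists k.+1, (centered x z (fun j => (z j).1 0%N)),
    (centered x' z' (fun j => (z' j).1 0%N)).
  have centered_pos (u : 'I_k -> fps2 K) v :
      (forall j, (u j).1 0%N = (u j).2 0%N) -> divides XX v ->
      forall i, divides XX (centered v u (fun j => (u j).1 0%N) i).
    move=> uu pv i; case: (unliftP ord0 i) => [j|] ->; rewrite ?centered0 ?centeredS //.
    apply/divides_XXP; split.
      rewrite -[(_ - _).1]/((u j).1 - ((u j).1 0%N)%:A).
      by rewrite fpsB fps_coef0C subrr.
    rewrite -[(_ - _).2]/((u j).2 - ((u j).1 0%N)%:A).
    by rewrite fpsB fps_coef0C uu subrr.
  rewrite /psalg2 !psalg_centered; split=> //.
  - exact: centered_pos.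
  - by apply: centered_pos => // j; rewrite -(z1 j) // -(z2 j).
  exists c => // i; case: (unliftP ord0 i) => [j|] ->;
    rewrite ?centered0 ?centeredS //.
  split=> n nc.
    rewrite -[(_ - _).1]/((z j).1 - ((z j).1 0%N)%:A).
    rewrite -[(_ - (_)%:A).1]/((z' j).1 - ((z' j).1 0%N)%:A).
    by rewrite !fpsB z1 // (z1 j 0%N).
  rewrite -[(_ - _).2]/((z j).2 - ((z j).1 0%N)%:A).
  rewrite -[(_ - (_)%:A).2]/((z' j).2 - ((z' j).1 0%N)%:A).
  by rewrite !fpsB z2 // (z1 j 0%N).
have split_gens v (u : 'I_k -> fps2 K) : (u j).1 0%N != (u j).2 0%N ->
    psalg2 ([set v] `|` range u) =
    psalg1 ([set v.1] `|` range (fst \o u)) `*`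
    psalg1 ([set v.2] `|` range (snd \o u)).
  move=> uj; rewrite psalg2_product.
    by rewrite !image_setU !image_set1 !image_comp.
  apply: idempotent_in uj; [exact: psalg_subalgebra|exact: psalg_closed|].
  by apply: sub_psalg; right; exists j.
have dif' : (z' j).1 0%N != (z' j).2 0%N by rewrite -(z1 j) // -(z2 j).
rewrite (split_gens _ _ dif) in Rc *; rewrite (split_gens _ _ dif').
have [Rc1 Rc2] := arf_bound2_prod Rc.
have [[pix1 pix2] [pix1' pix2']] := ((divides_pair _ _).1 pix, (divides_pair _ _).1 pix').
right; do 4?eexists; split; [reflexivity | reflexivity | |].
  by apply: parallel1_psalg => //; left; exists c.1.
by apply: parallel1_psalg => //; left; exists c.2.
Qed.

Lemma parallel_blowup R R' : parallel R R' ->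
  mult_star R = mult_star R' /\ parallel (blowup R) (blowup R').
Proof.
move=> [[k [y [y' [-> -> ypos y'pos [c Rc yy']]]]]|].
  have [x [x' [e [[Rx R'x'] [xe x'e] [pix pix'] [xx'1 xx'2] xy]]]] :=
    exists_min_nu ypos Rc yy'.
  have [z xz] := quotients_exist (fun i => (xy i).1).
  have [z' xz'] := quotients_exist (fun i => (xy i).2).
  have lR := pointed_local P2 (psalg_pointed P2 ypos).
  have lR' := pointed_local P2 (psalg_pointed P2 y'pos).
  have mR := mult2_psalg ypos Rx xe pix xz.
  have mR' := mult2_psalg y'pos R'x' x'e pix' xz'.
  have [ec1 ec2 Rce] := arf_bound2_blowup xe pix xz Rc.
  have nu1 f : divides XX f -> nu_ge f (1, 1)%N by rewrite nu_geP !expr1.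
  have bR : is_blowup (psalg2 (range y)) (psalg2 ([set x] `|` range z)).
    by left; split=> //; exists k, y, z, x, e; split=> // j; exact: nu1.
  have bR' : is_blowup (psalg2 (range y')) (psalg2 ([set x'] `|` range z')).
    by left; split=> //; exists k, y', z', x', e; split=> // j; exact: nu1.
  rewrite (blowup_eq bR) (blowup_eq bR').
  rewrite (mult_star_local lR mR) (mult_star_local lR' mR'); split=> //.
  have [[x1 x2] [e1 e2]] := ((nu_isP _ _).1 xe, (divides_XX_nu xe).1 pix).
  apply: parallel_after_blowup2 pix pix' Rce _ _ _ _ => /=.
  - by move=> n nc; apply: xx'1; lia.
  - by move=> n nc; apply: xx'2; lia.
  (* Exact because [e <= c]: the precision lost by the division equals the drop of the bound. *)
  - move=> j; have -> : (c.1 - e.1).+2 = (c.1.+2 - e.1)%N by lia.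
    apply: agree_below_div x1 (congr1 fst (xz j)) (congr1 fst (xz' j)) xx'1 _.
    by case: (yy' j).
  - move=> j; have -> : (c.2 - e.2).+2 = (c.2.+2 - e.2)%N by lia.
    apply: agree_below_div x2 (congr1 snd (xz j)) (congr1 snd (xz' j)) xx'2 _.
    by case: (yy' j).
move=> [R1 [R2 [R1' [R2' [-> -> par1 par2]]]]].
have [m1 [S1 [S1' [mR1 mR1' bR1 bR1' par1']]]] := parallel1_blowup par1.
have [m2 [S2 [S2' [mR2 mR2' bR2 bR2' par2']]]] := parallel1_blowup par2.
have [[p1 p1'] [p2 p2']] := (parallel1_pointed par1, parallel1_pointed par2).
have [l1 l1'] := (pointed_local P p1, pointed_local P p1').
have [l2 l2'] := (pointed_local P p2, pointed_local P p2').
have nl := product_not_local p1 p2; have nl' := product_not_local p1' p2'.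
have sR : splits (R1 `*` R2) R1 R2 by [].
have sR' : splits (R1' `*` R2') R1' R2' by [].
have bR : is_blowup (R1 `*` R2) (S1 `*` S2).
  by right; split=> //; exists R1, R2, S1, S2.
have bR' : is_blowup (R1' `*` R2') (S1' `*` S2').
  by right; split=> //; exists R1', R2', S1', S2'.
rewrite (blowup_eq bR) (blowup_eq bR').
rewrite (mult_star_splits nl sR mR1 mR2) (mult_star_splits nl' sR' mR1' mR2').
by split=> //; right; exists S1, S2, S1', S2'.
Qed.

Lemma parallel_mult_tree R R' : parallel R R' -> mult_tree R = mult_tree R'.
Proof.
move=> RR'.
have levels m : parallel (blowup_seq R m) (blowup_seq R' m).
  by elim: m => [|m /parallel_blowup[_]].
have nodes m : mult_star (blowup_seq R m) = mult_star (blowup_seq R' m).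
  by have [] := parallel_blowup (levels m).
by congr MultiplicityTree; apply/funext => p; rewrite /mkset !nodes.
Qed.

End TwoBranches.

Theorem theorem4p1 (K : fieldType) (n : nat) (phi psi : 'I_n -> fps K)
    (c : nat * nat) :
  infinite_set [set: K]%classic ->
  is_two_branch_curve phi psi ->
  is_conductor (values (arf_closure (curve_ring phi psi))) c ->
  mult_tree (curve_ring phi psi) =
  mult_tree (curve_ring (fun i => fps_trunc c.1.+1 (phi i))
                        (fun i => fps_trunc c.2.+1 (psi i))).
Proof.
move=> _ [pos _] [cond _]; apply: parallel_mult_tree; left.
have pos0 i : phi i 0%N = 0 /\ psi i 0%N = 0.
  by have /nu_geP := pos i; rewrite !expr1 => /divides_XXP.
exists n, (fun i => (phi i, psi i)),
  (fun i => (fps_trunc c.1.+1 (phi i), fps_trunc c.2.+1 (psi i))).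
split=> // [i|i|]; try by apply/divides_XXP; exact: pos0.
(* Keeping the degrees up to [c + 1] is agreement below [c + 2]. *)
exists c => [B Barf RB d|j]; last by split=> m mc; rewrite /= /fps_trunc -ltnS mc.
(* The Arf closure is the intersection of the Arf rings containing the curve ring, so each of them
   contains the same [f]. *)
have [f Rf fcd] := cond d; exists f => //.
by apply: (Rf B); split=> //; exact: arf_subring_is_arf.
Qed.
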